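(* Let $1\le L\le N<M$ be integers and let $K$ be an $M\times M$ sample covariance matrix (positive semidefinite Hermitian) of rank $N$, with eigenvalue decomposition $K=UDU^{*}$, where $U$ is the $M\times M$ unitary matrix of eigenvectors and $D=\mathrm{diag}(d_1,\ldots,d_N,0,\ldots,0)$ is the $M\times M$ diagonal matrix of eigenvalues ordered from largest to smallest. Then $$\mathrm{invcov}_L(K)=U\,\mathrm{invcov}_L(D)\,U^{*},$$ the matrix $\mathrm{invcov}_L(D)$ is diagonal (so $\mathrm{invcov}_L(K)$ has the same eigenvector matrix $U$ as $K$), and the last $M-N$ eigenvalues of $\mathrm{invcov}_L(K)$, i.e. the last $M-N$ diagonal entries of $\mathrm{invcov}_L(D)$, are equal to one another and positive: the zero eigenvalues of $K$ are converted to equal positive values.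
   Context: For an $M\times M$ positive semidefinite matrix $A$ of rank $N$, $$\mathrm{invcov}_L(A):=\mathbb{E}_\Phi\big(\Phi^{*}(\Phi A\Phi^{*})^{-1}\Phi\big),$$ where $\Phi$ is an isotropically random $L\times M$ matrix with $\Phi\Phi^*=I_L$, i.e. distributed according to the Haar probability measure on $\{\Phi\in\mathbb{C}^{L\times M}:\Phi\Phi^*=I_L\}$, which is invariant under $\Phi\mapsto\Phi\Theta$ for every $M\times M$ unitary $\Theta$. The $L\times L$ matrix $\Phi A\Phi^{*}$ is invertible with probability one. $A^*$ denotes the conjugate transpose.
   Formalization: For L = N the expectation defining invcov_L diverges (e.g. L=N=1, M=2), so the matrix claim is stated and proved, with existence, for L < N; for all L ≤ N the same claims are given for the [0,+∞]-valued quadratic form v ↦ E[v*Φ*(ΦAΦ* )^{-1}Φv]. *)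

(* Defs.v *)
From HB Require Import structures.
From mathcomp Require Import all_boot all_order all_algebra.
From mathcomp Require Import spectral sesquilinear.
From mathcomp Require Import all_classical all_reals all_analysis.
From mathcomp.real_closed Require Import complex.

Set Implicit Arguments.
Unset Strict Implicit.
Unset Printing Implicit Defensive.

Import Order.TTheory GRing.Theory Num.Theory.
Local Open Scope ring_scope.
Local Open Scope classical_set_scope.
Local Open Scope complex_scope.
Local Open Scope sesquilinear_scope.

HB.instance Definition _ (R : realType) := isPointed.Build R[i] 0.

(* Generated by the real and imaginary parts of the entries: this is the
   Borel sigma-algebra of C^(L x M) = R^(2LM). *)
Definition mx_coord_sets (R : realType) (L M : nat) : set (set 'M[R[i]]_(L, M)) :=
  [set S | exists (i : 'I_L) (j : 'I_M) (B : set R), measurable B /\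
     (S = [set Phi : 'M[R[i]]_(L, M) | B (complex.Re (Phi i j))] \/
      S = [set Phi : 'M[R[i]]_(L, M) | B (complex.Im (Phi i j))])].

Definition cmatrix (R : realType) (L M : nat) :=
  g_sigma_algebraType (@mx_coord_sets R L M).

Section Invcov.
Context {R : realType} {L M : nat}.
Implicit Types (P : probability (cmatrix R L M) R) (A : 'M[R[i]]_M).

(* [Phi \is unitarymx] reads Phi *m Phi^t* = 1%:M, also for a rectangular Phi.
   The unitary group acts transitively on such Phi, so these two conditions
   determine P. *)
Definition haar_stiefel P : Prop :=
  P [set Phi : 'M[R[i]]_(L, M) | Phi \is unitarymx] = 1%E /\
  forall Theta : 'M[R[i]]_M, Theta \is unitarymx ->
    forall B : set (cmatrix R L M), measurable B ->
      P [set Phi : 'M[R[i]]_(L, M) | B (Phi *m Theta)] = P B.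

(* [invmx] is the identity on singular matrices; under a Haar P and for
   L <= \rank A the compression Phi *m A *m Phi^t* is almost surely invertible. *)
Definition invcov_integrand A (Phi : 'M[R[i]]_(L, M)) : 'M[R[i]]_M :=
  Phi^t* *m invmx (Phi *m A *m Phi^t*) *m Phi.

Definition invcov_exists P A : Prop :=
  forall i j : 'I_M,
    P.-integrable setT
      (fun Phi => (complex.Re (invcov_integrand A Phi i j))%:E) /\
    P.-integrable setT
      (fun Phi => (complex.Im (invcov_integrand A Phi i j))%:E).

(* Entrywise expectation; meaningful only under [invcov_exists]. *)
Definition invcov P A : 'M[R[i]]_M :=
  \matrix_(i, j)
    (fine 'E_P[fun Phi => complex.Re (invcov_integrand A Phi i j)] +i*
     fine 'E_P[fun Phi => complex.Im (invcov_integrand A Phi i j)]).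

(* For A positive semidefinite the random quadratic form is nonnegative, so its
   expectation is defined in [0, +oo] even when the entries of
   [invcov_integrand A] are not integrable; when they are, it is
   v^t* *m invcov P A *m v. *)
Definition invcov_form P A (v : 'cV[R[i]]_M) : \bar R :=
  'E_P[fun Phi => complex.Re ((v^t* *m invcov_integrand A Phi *m v) 0 0)].

End Invcov.

Definition psdmx (R : realType) (M : nat) (A : 'M[R[i]]_M) : Prop :=
  A \is hermsymmx /\ forall v : 'cV[R[i]]_M, 0 <= (v^t* *m A *m v) 0 0.

(* Main.v *)
Require Import Defs.
From HB Require Import structures.
From mathcomp Require Import all_boot all_order all_algebra perm.
From mathcomp Require Import spectral sesquilinear.
From mathcomp Require Import all_classical all_reals all_analysis.
From mathcomp.real_closed Require Import complex.
From mathcomp Require Import measurable_realfun.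
From mathcomp Require Import ring lra.

Set Implicit Arguments.
Unset Strict Implicit.
Unset Printing Implicit Defensive.

Import Order.TTheory GRing.Theory Num.Theory.
Local Open Scope ring_scope.
Local Open Scope classical_set_scope.
Local Open Scope sesquilinear_scope.

(** The law of [Phi] is invariant under [Phi |-> Phi U], and
    [X_A(Phi) := Phi^* (Phi A Phi^* )^-1 Phi] satisfies
    [X_A(Phi U) = U^* X_(U A U^* )(Phi) U]; this gives equivariance, and sign
    changes and transpositions commuting with [D] give diagonality and the
    equality of the last entries.  Positivity needs no almost sure
    invertibility: if an entry of index [i >= N] vanished, then almost surely
    [(Phi^* Phi)_ji = 0] for some [j < N], in every orthonormal frame by
    invariance, so that the projection [Phi^* Phi] of rank [0 < L < M] would be
    scalar.

    Integrability for [L < N] is an integration by parts.  Write [X] for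
    [X_(D + e)] with [e > 0] and let [j < N <= k].  Differentiating the
    expectation of [X_kj] along the rotations of the plane [(j, k)] gives
    [E (X_kk - X_jj - d_j X_kk X_jj) = 0].  Summing over [j < N], with
    [X_jj <= 1 / d_j] and [sum_j (d_j + e) X_jj = tr 1 = L], yields
    [(N - L) E X_kk <= sum_(j < N) 1 / d_j] uniformly in [e], and Fatou's lemma
    lets [e] tend to [0].  Derivatives are replaced by an expansion in the
    tangent [t] of the angle with an explicit remainder [O(t^2)]. *)

(** * Positive semidefinite matrices and compressed inverses *)

Section ConjugateTranspose.
Variable C : numClosedFieldType.

Lemma ctmxM m n p (A : 'M[C]_(m, n)) (B : 'M[C]_(n, p)) :
  (A *m B)^t* = B^t* *m A^t*.
Proof. by rewrite trmx_mul map_mxM. Qed.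

Lemma ctmxD m n (A B : 'M[C]_(m, n)) : (A + B)^t* = A^t* + B^t*.
Proof. by apply/matrixP => i j; rewrite !mxE rmorphD. Qed.

Lemma ctmxB m n (A B : 'M[C]_(m, n)) : (A - B)^t* = A^t* - B^t*.
Proof. by apply/matrixP => i j; rewrite !mxE rmorphB. Qed.

Lemma ctmxZ m n a (A : 'M[C]_(m, n)) : (a *: A)^t* = a^* *: A^t*.
Proof. by apply/matrixP => i j; rewrite !mxE rmorphM. Qed.

Lemma ctmx_delta m n i j :
  (delta_mx i j : 'M[C]_(m, n))^t* = delta_mx j i.
Proof.
by apply/matrixP => a b; rewrite !mxE andbC; case: (_ && _); rewrite ?rmorph1 ?rmorph0.
Qed.

Lemma ctmx1 n : (1%:M : 'M[C]_n)^t* = 1%:M.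
Proof. by rewrite trmx1 map_mx1. Qed.

Lemma ctmx_inv n (A : 'M[C]_n) : (invmx A)^t* = invmx (A^t*).
Proof. by rewrite trmx_inv map_invmx. Qed.

Lemma unitary_mulVmx n (U : 'M[C]_n) : U \is unitarymx -> U^t* *m U = 1%:M.
Proof. by move=> /unitarymxP/mulmx1C. Qed.

Lemma unitary_mulmxr m n (F : 'M[C]_(m, n)) (U : 'M[C]_n) : U \is unitarymx ->
  (F *m U \is unitarymx) = (F \is unitarymx).
Proof.
move=> uU; apply/idP/idP => [|uF]; last exact: mul_unitarymx.
move=> /(mul_unitarymx (B := U^t*)); rewrite trmxC_unitary => /(_ uU).
by rewrite -mulmxA (unitarymxP uU) mulmx1.
Qed.

Definition qform n (A : 'M[C]_n) (v : 'cV[C]_n) : C := (v^t* *m A *m v) 0 0.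

Lemma mx_entryE m n (A : 'M[C]_(m, n)) i j :
  A i j = ((delta_mx i (0 : 'I_1))^t* *m A *m delta_mx j (0 : 'I_1)) 0 0.
Proof. by rewrite ctmx_delta -rowE -colE !mxE. Qed.

Lemma qform_delta n (A : 'M[C]_n) i : qform A (delta_mx i 0) = A i i.
Proof. by rewrite /qform ctmx_delta -rowE -colE !mxE. Qed.

Lemma qform_congr m n (A : 'M[C]_n) (F : 'M[C]_(m, n)) v :
  qform (F *m A *m F^t*) v = qform A (F^t* *m v).
Proof. by rewrite /qform ctmxM trmxCK !mulmxA. Qed.

Lemma qform_diag n (a : 'rV[C]_n) v :
  qform (diag_mx a) v = \sum_i a 0 i * `|v i 0| ^+ 2.
Proof.
rewrite /qform -mulmxA mul_diag_mx mxE; apply: eq_bigr => i _.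
by rewrite !mxE normCK mulrCA [v i 0 * _]mulrC.
Qed.

Lemma qform1 n (v : 'cV[C]_n) : qform 1%:M v = \sum_i `|v i 0| ^+ 2.
Proof.
rewrite /qform mulmx1 mxE; apply: eq_bigr => i _.
by rewrite !mxE normCK mulrC.
Qed.

Lemma qform1_ge_coord n (v : 'cV[C]_n) i : `|v i 0| ^+ 2 <= qform 1%:M v.
Proof.
rewrite qform1 (bigD1 i) //= lerDl sumr_ge0 // => j _; exact: exprn_ge0.
Qed.

Definition psd n (A : 'M[C]_n) := A^t* = A /\ forall v, 0 <= qform A v.

Lemma psd_diag_ge0 n (A : 'M[C]_n) i : psd A -> 0 <= A i i.
Proof. by case=> _ /(_ (delta_mx i 0)); rewrite qform_delta. Qed.

Lemma psd_congr m n (A : 'M[C]_n) (F : 'M[C]_(m, n)) :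
  psd A -> psd (F *m A *m F^t*).
Proof.
move=> [hA pA]; split; first by rewrite !ctmxM trmxCK hA mulmxA.
by move=> v; rewrite qform_congr.
Qed.

Lemma psd_inv n (A : 'M[C]_n) : psd A -> psd (invmx A).
Proof.
move=> [hA pA]; split; first by rewrite ctmx_inv hA.
(* A singular matrix is its own [invmx], so the claim is then the hypothesis; otherwise substitute
   [invmx A *m v]. *)
move=> v; have [uA|nA] := boolP (A \in unitmx); last by rewrite invmx_out.
suff -> : qform (invmx A) v = qform A (invmx A *m v) by exact: pA.
rewrite /qform ctmxM ctmx_inv hA -!mulmxA; congr (_ 0 0); congr (_ *m _).
by rewrite (mulmxA A) mulmxV // mul1mx.
Qed.

Lemma psd_diag n (a : 'rV[C]_n) : (forall i, 0 <= a 0 i) -> psd (diag_mx a).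
Proof.
move=> a0; split.
  apply/matrixP => i j; rewrite !mxE eq_sym; case: eqP => [->|_].
    by rewrite !mulr1n; apply: CrealP; rewrite realE a0.
  by rewrite !mulr0n rmorph0.
by move=> v; rewrite qform_diag sumr_ge0 // => i _; rewrite mulr_ge0 // exprn_ge0.
Qed.

Lemma psd_entryC n (A : 'M[C]_n) i j : psd A -> A j i = (A i j)^*.
Proof. by case=> h _; rewrite -[in LHS]h !mxE. Qed.

(** The form at [e_i - w e_j], with [w] a phase turning [A i j] into its modulus, is nonnegative.
    The bound is linear in the diagonal, so integrability of the diagonal entries passes to all
    entries. *)
Lemma psd_entry_le n (A : 'M[C]_n) i j : psd A ->
  `|A i j| <= (A i i + A j j) / 2.
Proof.
move=> psdA; have [A0|An0] := eqVneq (A i j) 0.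
  by rewrite A0 normr0 divr_ge0 // addr_ge0 // psd_diag_ge0.
pose w : C := (A i j)^* / `|A i j|.
have nA0 : `|A i j| != 0 by rewrite normr_eq0.
have ww : w * A i j = `|A i j|.
  by rewrite /w mulrAC [_ * A i j]mulrC -normCK expr2 -mulrA divff // mulr1.
have wC : w^* * A j i = `|A i j|.
  by rewrite (psd_entryC i j psdA) -rmorphM ww; apply: CrealP.
have w1 : w^* * w = 1.
  rewrite mulrC -normCK /w normrM normfV normr_id norm_conjC divff // expr1n //.
have := psdA.2 (delta_mx i 0 - w *: delta_mx j 0).
suff -> : qform A (delta_mx i 0 - w *: delta_mx j 0)
   = A i i + A j j - `|A i j| *+ 2.
  by rewrite subr_ge0 ler_pdivlMr // mulr_natr.
rewrite /qform ctmxB ctmxZ !ctmx_delta mulmxBr !mulmxBl.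
rewrite -!scalemxAr -!scalemxAl -!rowE -!colE !mxE.
rewrite ww wC mulrA [w * w^*]mulrC w1 mul1r; ring.
Qed.

Lemma posdef_unitmx n (A : 'M[C]_n) :
  (forall v, v != 0 -> qform A v != 0) -> A \in unitmx.
Proof.
move=> posA; rewrite -unitmx_tr -row_free_unit -kermx_eq0.
apply: contraT => /rowV0Pn [u /sub_kermxP uA u0].
have := posA u^T; rewrite trmx_eq0 => /(_ u0).
by rewrite /qform -mulmxA -[A *m _]trmxK trmx_mul trmxK uA trmx0 mulmx0 mxE eqxx.
Qed.

Lemma qform1_eq0 n (v : 'cV[C]_n) : (qform 1%:M v == 0) = (v == 0).
Proof.
apply/eqP/eqP => [v0|->]; last by rewrite /qform mulmx0 mxE.
apply/matrixP => i j; rewrite (ord1 j) mxE; apply/eqP.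
have : `|v i 0| ^+ 2 == 0 by rewrite eq_le exprn_ge0 // -v0 qform1_ge_coord.
by rewrite expf_eq0 /= normr_eq0.
Qed.

Section Compression.
Variables (L M : nat).
Implicit Types (A B : 'M[C]_M) (F : 'M[C]_(L, M)).

(* [invcov_integrand] over an arbitrary closed field; [invmx] is the identity on
   singular compressions. *)
Definition cinv A F : 'M[C]_M := F^t* *m invmx (F *m A *m F^t*) *m F.

(** Both sides invert the same compression, singular or not. With the invariance of the law this
    moves a unitary [T] from the random matrix to [A], the source of all symmetries below. *)
Lemma cinv_mulr A F (T : 'M[C]_M) :
  cinv A (F *m T) = T^t* *m cinv (T *m A *m T^t*) F *m T.
Proof. by rewrite /cinv ctmxM !mulmxA. Qed.

Lemma psd_cinv A F : psd A -> psd (cinv A F).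
Proof.
move=> pA; rewrite /cinv -[X in _ *m X]trmxCK.
exact/psd_congr/psd_inv/psd_congr.
Qed.

Lemma compression_unit A F : F \is unitarymx ->
  (forall v, v != 0 -> qform A v != 0) -> F *m A *m F^t* \in unitmx.
Proof.
move=> /unitarymxP uF posA; apply: posdef_unitmx => v v0.
rewrite qform_congr; apply: posA; apply: contra_neq v0 => Fv0.
by rewrite -[v]mul1mx -uF -mulmxA Fv0 mulmx0.
Qed.

(** Completing the square: with [H] the compression, the two sides differ by the form of [H] at
    [H^-1 F e - z]. The left side is affine in [A], which permits comparing the compressed inverses
    of two matrices. *)
Lemma cinv_variational A F (z : 'cV[C]_L) e : psd A ->
  F *m A *m F^t* \in unitmx ->
  (z^t* *m (F *m e)) 0 0 + ((z^t* *m (F *m e)) 0 0)^* - qform A (F^t* *m z)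
    <= qform (cinv A F) e.
Proof.
move=> pA; rewrite -qform_congr; have := psd_congr F pA.
rewrite /cinv; move: (F *m A *m F^t*) => H [hH pH] uH.
rewrite -[X in qform (_ *m _ *m X)]trmxCK qform_congr trmxCK.
move: (F *m e) => u; rewrite -subr_ge0.
suff -> : qform (invmx H) u - ((z^t* *m u) 0 0 + ((z^t* *m u) 0 0)^* - qform H z)
   = qform H (invmx H *m u - z) by exact: pH.
have -> : ((z^t* *m u) 0 0)^* = (u^t* *m z) 0 0.
  by rewrite -[u in RHS]trmxCK -[z in RHS]trmxCK trmxCK -ctmxM !mxE.
rewrite /qform ctmxB ctmxM ctmx_inv hH !mulmxBl !mulmxBr -!mulmxA mulKVmx //.
rewrite mulKmx //.
have sub00 (P Q : 'M[C]_1) : (P - Q) 0 0 = P 0 0 - Q 0 0 by rewrite !mxE.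
by rewrite !sub00; ring.
Qed.

Lemma cinv_sandwich A F : F *m A *m F^t* \in unitmx ->
  cinv A F *m A *m cinv A F = cinv A F.
Proof.
move=> uH; rewrite /cinv !mulmxA.
have -> : F^t* *m invmx (F *m A *m F^t*) *m F *m A *m F^t* =
  F^t* *m invmx (F *m A *m F^t*) *m (F *m A *m F^t*) by rewrite !mulmxA.
by rewrite mulmxKV.
Qed.

(* Testing the quadratic form of [A] on [F^t* W F e_k], with
   [W = (F A F^t* )^-1], returns the entry [(k, k)] itself. *)
Lemma cinv_diag_le A F k (a : C) : psd A -> F *m A *m F^t* \in unitmx ->
  0 < a -> (forall v : 'cV[C]_M, a * `|v k 0| ^+ 2 <= qform A v) ->
  cinv A F k k <= a^-1.
Proof.
move=> pA uH a0 aA; pose y : 'cV[C]_M := cinv A F *m delta_mx k 0.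
have yk : y k 0 = cinv A F k k by rewrite /y -colE mxE.
have qy : qform A y = cinv A F k k.
  rewrite -(qform_delta (cinv A F)) -[in RHS](cinv_sandwich uH) /qform /y ctmxM.
  by rewrite (psd_cinv F pA).1 !mulmxA.
have q0 : 0 <= cinv A F k k by rewrite -qy; case: pA.
have := aA y; rewrite qy yk ger0_norm //.
have [->|qn0] := eqVneq (cinv A F k k) 0.
  by move=> _; rewrite invr_ge0 ltW.
rewrite expr2 mulrA -[X in _ <= X]mul1r ler_pM2r ?lt_def ?qn0 //.
by rewrite -ler_pdivlMl // mulr1.
Qed.

Lemma trace_cinv A F : F *m A *m F^t* \in unitmx ->
  \tr (cinv A F *m A) = L%:R.
Proof.
move=> uH; rewrite /cinv -!mulmxA mxtrace_mulC -!mulmxA (mulmxA F A) mulVmx //.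
exact: mxtrace1.
Qed.

(** The resolvent identity [W_B = W_A - W_A (H_B - H_A) W_B] for the inverses of the compressions,
    carried back by [F]. *)
Lemma cinv_resolvent A B F :
  F *m A *m F^t* \in unitmx -> F *m B *m F^t* \in unitmx ->
  cinv B F = cinv A F - cinv A F *m (B - A) *m cinv B F.
Proof.
move=> uA uB; rewrite mulmxBr mulmxBl /cinv !mulmxA.
have -> : F^t* *m invmx (F *m A *m F^t*) *m F *m B *m F^t* =
  F^t* *m invmx (F *m A *m F^t*) *m (F *m B *m F^t*) by rewrite !mulmxA.
have -> : F^t* *m invmx (F *m A *m F^t*) *m F *m A *m F^t* =
  F^t* *m invmx (F *m A *m F^t*) *m (F *m A *m F^t*) by rewrite !mulmxA.
by rewrite mulmxKV // mulmxK // opprB addrC subrK.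
Qed.

End Compression.

End ConjugateTranspose.

(** * Plane rotations *)

Section FirstOrderExpansion.
Variable C : numClosedFieldType.
Implicit Types (x y a b : C).

Lemma normM_le x y a b : `|x| <= a -> `|y| <= b -> `|x * y| <= a * b.
Proof. by move=> xa yb; rewrite normrM ler_pM. Qed.

Lemma normM1_le x y b : `|x| <= 1 -> `|y| <= b -> `|x * y| <= b.
Proof. by move=> x1 yb; rewrite -[b]mul1r; exact: normM_le. Qed.

Lemma normD_le x y a b : `|x| <= a -> `|y| <= b -> `|x + y| <= a + b.
Proof. by move=> xa yb; rewrite (le_trans (ler_normD _ _)) // lerD. Qed.

Lemma normB_le x y a b : `|x| <= a -> `|y| <= b -> `|x - y| <= a + b.
Proof. by move=> xa yb; apply: normD_le; rewrite ?normrN. Qed.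

(** With entries at most [K] and phases of modulus one, this bounds the increment of a resolvent
    entry per unit of [t]; [rotation_const] bounds the second-order remainder [U] below, summand by
    summand. Only the power of [t] in front of them matters. *)
Definition resolvent_const (d K : C) := d * ((K * K + K * K) + (K * K + K * K)).

Definition rotation_const (d K : C) :=
  let S := resolvent_const d K in
  S + S + K + K + d * (K * (S + K) + K * (S + K)) + d * (K * K + K * K).

(* [b] and [c] stand for entries of the compressed inverses of [A] and of its
   conjugate under a rotation of the plane of the indices [a] and [c], with
   [k] the squared cosine and [t] the tangent of the angle; the last three
   equations are the resolvent identity. *)
Lemma first_order_expansion (t k d K w w' baa bca bcc caa cac cca ccc : C) :
  0 <= t <= 1 -> k * (1 + t ^+ 2) = 1 -> 0 <= d ->
  `|w| = 1 -> `|w'| = 1 -> w' * w = 1 ->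
  `|baa| <= K -> `|bca| <= K -> `|bcc| <= K -> forall bac, `|bac| <= K ->
  `|caa| <= K -> `|cac| <= K -> `|cca| <= K -> `|ccc| <= K ->
  let step x_a x_c a_y c_y :=
    d * (k * (x_a + t * w * x_c) * (a_y + t * w' * c_y) - x_a * a_y) in
  caa = baa - step baa bac caa cca ->
  cca = bca - step bca bcc caa cca ->
  ccc = bcc - step bca bcc cac ccc ->
  `|w' * (cca + t * w * (ccc - caa) - t ^+ 2 * w ^+ 2 * cac)
    - (1 + t ^+ 2) * w' * bca
    - t * (bcc - baa - d * (bcc * baa + (w' * bca) ^+ 2))|
   <= t ^+ 2 * rotation_const d K.
Proof.
move=> /andP[t0 t1] kt d0 w1 w'1 w'w Kbaa Kbca Kbcc bac Kbac Kcaa Kcac Kcca Kccc.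
move=> step Ecaa Ecca Eccc.
have t2_0 : 0 <= t ^+ 2 by rewrite exprn_ge0.
have pos : 0 < 1 + t ^+ 2 by rewrite ltr_pwDl.
have k0 : 0 <= k by rewrite -(pmulr_lge0 _ pos) kt.
have k1 : k <= 1 by rewrite -kt ler_peMr // lerDl.
have nk : `|k| <= 1 by rewrite ger0_norm.
have nt : `|t| <= 1 by rewrite ger0_norm.
have nd : `|d| <= d by rewrite ger0_norm.
have nw : `|w| <= 1 by rewrite w1.
have nw' : `|w'| <= 1 by rewrite w'1.
(* As [k (1 + t^2) = 1], the terms of order zero in [step] cancel and it is divisible by [t]; [S] is
   minus the quotient, with a bound independent of [t]. *)
pose S x_a x_c a_y c_y :=
  - (d * (k * ((w * (x_c * a_y) + w' * (x_a * c_y)) + t * (x_c * c_y - x_a * a_y)))).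
have SE x_a x_c a_y c_y : - step x_a x_c a_y c_y = t * S x_a x_c a_y c_y.
  apply/eqP; rewrite -subr_eq0; apply/eqP.
  transitivity (d * (x_a * a_y) * (1 - k * (1 + t ^+ 2))
    + d * k * t ^+ 2 * x_c * c_y * (1 - w' * w)); last by rewrite kt w'w; ring.
  by rewrite /step /S; ring.
have nS x_a x_c a_y c_y : `|x_a| <= K -> `|x_c| <= K -> `|a_y| <= K -> `|c_y| <= K ->
    `|S x_a x_c a_y c_y| <= resolvent_const d K.
  move=> *; rewrite /S /resolvent_const normrN; apply: normM_le => //.
  apply: normM1_le => //; apply: normD_le.
    by apply: normD_le; apply: normM1_le => //; exact: normM_le.
  by apply: normM1_le => //; apply: normB_le; exact: normM_le.
have := nS _ _ _ _ Kbaa Kbac Kcaa Kcca.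
have := nS _ _ _ _ Kbca Kbcc Kcaa Kcca.
have := nS _ _ _ _ Kbca Kbcc Kcac Kccc.
have : S bca bcc caa cca = - (d * (k * ((w * (bcc * caa) + w' * (bca * cca))
  + t * (bcc * cca - bca * caa)))) by [].
have : caa - baa - t * S baa bac caa cca = 0 by rewrite -SE {1}Ecaa; ring.
have : cca - bca - t * S bca bcc caa cca = 0 by rewrite -SE {1}Ecca; ring.
have : ccc - bcc - t * S bca bcc cac ccc = 0 by rewrite -SE {1}Eccc; ring.
move: (S baa _ _ _) (S bca _ caa _) (S bca _ cac _) => saa sca scc.
move=> Hcc Hca Haa Hs nscc nsca nsaa.
(* [U] is the exact remainder divided by [t ^+ 2], written in the quotients [saa], [sca] and
   [scc]. *)
pose U := scc - saa - w * cac - w' * bca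
  - d * (bcc * (saa - k * (t * caa)) + w' * (w' * (bca * (sca - k * (t * cca)))))
  - d * (k * (w' * (bcc * cca - bca * caa))).
suff -> : w' * (cca + t * w * (ccc - caa) - t ^+ 2 * w ^+ 2 * cac)
    - (1 + t ^+ 2) * w' * bca
    - t * (bcc - baa - d * (bcc * baa + (w' * bca) ^+ 2)) = t ^+ 2 * U.
  rewrite normrM [`|t ^+ 2|]ger0_norm // ler_wpM2l // /U /rotation_const.
  apply: normB_le; last first.
    apply: normM_le => //; do 2 apply: normM1_le => //.
    by apply: normB_le; exact: normM_le.
  apply: normB_le; last first.
    apply: normM_le => //; apply: normD_le; last do 2 apply: normM1_le => //.
      apply: normM_le => //; apply: normB_le => //.
      by do 2 apply: normM1_le => //.
    apply: normM_le => //; apply: normB_le => //.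
    by do 2 apply: normM1_le => //.
  do 2 (apply: normB_le; last by apply: normM1_le).
  exact: normB_le.
apply/eqP; rewrite -subr_eq0; apply/eqP.
have h1 : w' * w - 1 = 0 by rewrite w'w subrr.
have h2 : k * (1 + t ^+ 2) - 1 = 0 by rewrite kt subrr.
have h3 : sca + d * (k * ((w * (bcc * caa) + w' * (bca * cca))
  + t * (bcc * cca - bca * caa))) = 0 by rewrite Hs; ring.
(* A certificate: the difference is a combination of the relations collected above, each of which
   vanishes, and [ring] verifies the coefficients. *)
transitivity (w' * (cca - bca - t * sca)
  + w' * t * (sca + d * (k * ((w * (bcc * caa) + w' * (bca * cca))
     + t * (bcc * cca - bca * caa))))
  + (w' * w - 1) * (t * (ccc - caa) - t ^+ 2 * w * cac - d * k * t * bcc * caa)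
  + t * (ccc - bcc - t * scc) - t * (caa - baa - t * saa)
  - d * t * (bcc * caa + w' ^+ 2 * bca * cca) * (k * (1 + t ^+ 2) - 1)
  - d * t * bcc * (caa - baa - t * saa)
  - d * t * w' ^+ 2 * bca * (cca - bca - t * sca)); first by rewrite /U; ring.
by rewrite Hcc Hca Haa h1 h2 h3; ring.
Qed.

End FirstOrderExpansion.

Section PlaneRotation.
Variables (C : numClosedFieldType) (M : nat) (j k : 'I_M) (c t w : C).
Hypotheses (jk : j != k) (c_real : c^* = c) (t_real : t^* = t).
Hypotheses (ct : c ^+ 2 * (1 + t ^+ 2) = 1) (w1 : `|w| = 1).

(** [c] is the cosine, [t] the tangent and [c * t] the sine of the angle; [w] is a phase.
    Parametrizing by the tangent confines square roots to [c], and the expansions see only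
    [c ^+ 2]. *)
Definition rotation : 'M[C]_M :=
  1%:M + ((c - 1) *: (delta_mx j j + delta_mx k k)
    + ((c * t * w) *: delta_mx k j - (c * t * w^*) *: delta_mx j k)).

Lemma rotation_unitary : rotation \is unitarymx.
Proof.
have kj : k != j by rewrite eq_sym.
have ww : w * w^* = 1 by rewrite -normCK w1 expr1n.
apply/unitarymxP; rewrite /rotation ctmxD ctmx1 ctmxD ctmxB !ctmxZ ctmxD !ctmx_delta.
rewrite !rmorphM rmorphB rmorph1 /= conjC1 conjCK c_real t_real.
rewrite !(mulmxDl, mulmxDr, mulNmx, mulmxN) !mul1mx !mulmx1.
rewrite -!(scalemxAl, scalemxAr) !(mulmxDl, mulmxDr) !mul_delta_mx_cond.
rewrite !eqxx (negPf jk) (negPf kj) !mulr0n !mulr1n.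
apply/matrixP => a b; rewrite !mxE.
move: ((a == j) && (b == j))%:R ((a == k) && (b == k))%:R => x y.
move: ((a == j) && (b == k))%:R ((a == k) && (b == j))%:R => z u.
apply/eqP; rewrite -subr_eq0; apply/eqP.
transitivity ((x + y) * (c ^+ 2 * (1 + t ^+ 2) - 1)
   + (x + y) * c ^+ 2 * t ^+ 2 * (w * w^* - 1)); first by ring.
by rewrite ct ww; ring.
Qed.

Lemma rotation_colj :
  rotation *m delta_mx j 0 = c *: (delta_mx j 0 + (t * w) *: delta_mx k 0) :> 'cV_M.
Proof.
have kj : k != j by rewrite eq_sym.
rewrite /rotation !(mulmxDl, mulNmx) mul1mx -!scalemxAl !mulmxDl !mul_delta_mx_cond.
rewrite !eqxx ?(negPf jk) ?(negPf kj) !mulr0n !mulr1n.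
by apply/matrixP => a b; rewrite !mxE; ring.
Qed.

Lemma rotation_colk :
  rotation *m delta_mx k 0 = c *: (delta_mx k 0 - (t * w^*) *: delta_mx j 0) :> 'cV_M.
Proof.
have kj : k != j by rewrite eq_sym.
rewrite /rotation !(mulmxDl, mulNmx) mul1mx -!scalemxAl !mulmxDl !mul_delta_mx_cond.
rewrite !eqxx ?(negPf jk) ?(negPf kj) !mulr0n !mulr1n.
by apply/matrixP => a b; rewrite !mxE; ring.
Qed.

Lemma rotation_col i : i != j -> i != k ->
  rotation *m delta_mx i 0 = delta_mx i 0 :> 'cV_M.
Proof.
move=> ij ik; have ji : j != i by rewrite eq_sym.
have ki : k != i by rewrite eq_sym.
rewrite /rotation !(mulmxDl, mulNmx) mul1mx -!scalemxAl !mulmxDl !mul_delta_mx_cond.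
rewrite (negPf ji) (negPf ki) !mulr0n.
by apply/matrixP => a b; rewrite !mxE; ring.
Qed.

Let u : 'cV[C]_M := rotation *m delta_mx j 0.

(** The scalar matrix [a 0 k] commutes with the rotation; what remains of the diagonal vanishes at
    [k], and the rotation fixes every basis vector other than [e_j] and [e_k]. Only the rank-one
    term of index [j] moves. *)
Lemma rotation_diag (a : 'rV[C]_M) :
  rotation *m diag_mx a *m rotation^t* - diag_mx a
  = (a 0 j - a 0 k) *: (u *m u^t* - delta_mx j j).
Proof.
pose e i : 'cV[C]_M := delta_mx i 0.
have diagE (b : 'rV[C]_M) : diag_mx b = \sum_i b 0 i *: (e i *m (e i)^t*).
  rewrite diag_mx_sum_delta; apply: eq_bigr => i _.
  by rewrite ctmx_delta mul_delta_mx.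
have -> : diag_mx a = (a 0 k)%:M + diag_mx (a - const_mx (a 0 k)).
  rewrite -diag_const_mx -raddfD /=; congr diag_mx.
  by apply/matrixP => x y; rewrite !mxE; ring.
set b := a - _; have bk : b 0 k = 0 by rewrite !mxE subrr.
have -> : a 0 j - a 0 k = b 0 j by rewrite !mxE.
rewrite mulmxDr mulmxDl mul_mx_scalar -scalemxAl.
rewrite (unitarymxP rotation_unitary) scalemx1 opprD addrACA subrr add0r.
rewrite diagE mulmx_sumr mulmx_suml -sumrB (bigD1 j) //= [X in _ + X]big1 ?addr0.
  rewrite -scalemxAr -scalemxAl -scalerBr !mulmxA /u ctmxM !mulmxA.
  by rewrite -(mulmxA rotation (e j)) !ctmx_delta mul_delta_mx.
move=> i ij; rewrite -scalemxAr -scalemxAl; have [->|ik] := eqVneq i k.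
  by rewrite bk !scale0r subrr.
by rewrite !mulmxA -[_ *m rotation^t*]mulmxA -ctmxM /e rotation_col // subrr.
Qed.

End PlaneRotation.

(** * Compressed inverses under a plane rotation *)

Section RotatedCompression.
Variables (C : numClosedFieldType) (L M : nat).
Implicit Types (A : 'M[C]_M) (F : 'M[C]_(L, M)) (a : 'rV[C]_M).

Lemma qform_diag_ge a (e : C) v : (forall i, e <= a 0 i) ->
  e * qform 1%:M v <= qform (diag_mx a) v.
Proof.
move=> ea; rewrite qform1 qform_diag mulr_sumr ler_sum // => i _.
by rewrite ler_wpM2r // exprn_ge0.
Qed.

Lemma coercive_unit A F (e : C) : 0 < e ->
  (forall v, e * qform 1%:M v <= qform A v) -> F \is unitarymx ->
  F *m A *m F^t* \in unitmx.
Proof.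
move=> e0 eA uF; apply: compression_unit => // v v0.
have v1 : 0 < qform 1%:M v.
  by rewrite lt_def qform1_eq0 v0 qform1 sumr_ge0 // => i _; rewrite exprn_ge0.
by rewrite gt_eqF // (lt_le_trans _ (eA v)) // mulr_gt0.
Qed.

Lemma cinv_entry_le A F (e : C) x y : 0 < e -> psd A ->
  (forall v, e * qform 1%:M v <= qform A v) -> F \is unitarymx ->
  `|cinv A F x y| <= e^-1.
Proof.
move=> e0 pA eA uF.
have X i : cinv A F i i <= e^-1.
  apply: cinv_diag_le => //; first exact: coercive_unit eA uF.
  by move=> v; apply: le_trans (eA v); rewrite ler_pM2l // qform1_ge_coord.
apply: (le_trans (psd_entry_le x y (psd_cinv F pA))).
rewrite ler_pdivrMr // mulr_natr mulr2n; exact: lerD.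
Qed.

Lemma coercive_conj A (e : C) (U : 'M[C]_M) v : U \is unitarymx ->
  (forall v, e * qform 1%:M v <= qform A v) ->
  e * qform 1%:M v <= qform (U *m A *m U^t*) v.
Proof.
move=> /unitarymxP uU eA; rewrite qform_congr; apply: le_trans (eA _).
by rewrite -qform_congr mulmx1 uU.
Qed.

Variables (j k : 'I_M) (c t w : C).
Hypotheses (jk : j != k) (c_real : c^* = c).
Hypotheses (t01 : 0 <= t <= 1) (ct : c ^+ 2 * (1 + t ^+ 2) = 1) (w1 : `|w| = 1).

(** [cinv_mulr] trades the rotated argument for the rotated matrix, whose compressed inverse [Y] is
    compared with [X] by the resolvent identity; the perturbation is a difference of two rank-one
    matrices. The factor [1 + t ^+ 2] cancels the [c ^+ 2] of the two rotated columns. *)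
Lemma cinv_rotation_expansion a F (e : C) : 0 < e -> (forall i, e <= a 0 i) ->
  a 0 k <= a 0 j -> F \is unitarymx ->
  let X := cinv (diag_mx a) F in let d := a 0 j - a 0 k in
  `|w^* * ((1 + t ^+ 2) * cinv (diag_mx a) (F *m rotation j k c t w) k j)
     - (1 + t ^+ 2) * w^* * X k j
     - t * (X k k - X j j - d * (X k k * X j j + (w^* * X k j) ^+ 2))|
   <= t ^+ 2 * rotation_const d e^-1.
Proof.
move=> e0 ea akj uF; simpl; set X := cinv _ F; set d := a 0 j - _.
have t_real : t^* = t by apply: CrealP; case/andP: t01 => t0 _; rewrite realE t0.
set A := diag_mx a; set T := rotation j k c t w.
have uT : T \is unitarymx by exact: rotation_unitary.
have pA : psd A by apply: psd_diag => i; rewrite (le_trans (ltW e0)).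
have eA v : e * qform 1%:M v <= qform A v by exact: qform_diag_ge.
have pA' : psd (T *m A *m T^t*) by exact: psd_congr.
have eA' v : e * qform 1%:M v <= qform (T *m A *m T^t*) v by exact: coercive_conj.
pose Y := cinv (T *m A *m T^t*) F.
(* The rotated column is [c (e_j + t w e_k)], so each entry of the resolvent identity becomes a
   scalar equation in which only the indices [j] and [k] are summed over. *)
have YX x y : Y x y = X x y - d * (c ^+ 2 * (X x j + t * w * X x k)
    * (Y j y + t * w^* * Y k y) - X x j * Y j y).
  have YE := cinv_resolvent (coercive_unit e0 eA uF) (coercive_unit e0 eA' uF).
  rewrite -/X -/Y rotation_diag // rotation_colj // -/d in YE.
  clearbody X Y.
  rewrite {1}YE -[X *m _]scalemxAr -(scalemxAl d); set u : 'cV[C]_M := c *: _.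
  rewrite -[delta_mx j j](mul_delta_mx (m := M) (n := 1) 0) mulmxBr mulmxBl.
  rewrite !mulmxA -!(mulmxA (X *m _)) -colE -rowE.
  have outer (p : 'cV[C]_M) (q : 'rV[C]_M) : (p *m q) x y = p x 0 * q 0 y.
    by rewrite mxE big_ord1.
  have sub2 (p q : 'M[C]_M) : (p - q) x y = p x y - q x y by rewrite !mxE.
  have scale2 (p : 'M[C]_M) : (d *: p) x y = d * p x y by rewrite mxE.
  rewrite sub2 scale2 sub2 !outer /u ctmxZ ctmxD ctmxZ !ctmx_delta.
  rewrite -scalemxAl mulmxDl -scalemxAl -!rowE -scalemxAr mulmxDr -scalemxAr -!colE.
  by rewrite !mxE rmorphM /= t_real c_real; ring.
have ZE : (1 + t ^+ 2) * cinv A (F *m T) k j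
    = Y k j + t * w * (Y k k - Y j j) - t ^+ 2 * w ^+ 2 * Y j k.
  rewrite cinv_mulr -/Y; clearbody X Y.
  have -> : (T^t* *m Y *m T) k j =
      ((T *m delta_mx k (0 : 'I_1))^t* *m Y *m (T *m delta_mx j (0 : 'I_1))) 0 0.
    by rewrite [LHS]mx_entryE ctmxM !mulmxA.
  rewrite rotation_colj // rotation_colk // ctmxZ ctmxB ctmxZ !ctmx_delta.
  rewrite -!scalemxAl -!scalemxAr !mulmxBl !mulmxDr -!scalemxAl -!scalemxAr.
  rewrite -!rowE -!colE !mxE rmorphM /= conjCK t_real c_real.
  by rewrite -[RHS]mul1r -[in RHS]ct; ring.
rewrite ZE.
have X_le x y : `|X x y| <= e^-1 by exact: cinv_entry_le eA uF.
have Y_le x y : `|Y x y| <= e^-1 by exact: cinv_entry_le eA' uF.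
apply: (@first_order_expansion _ t (c ^+ 2) d _ w w^* _ _ _ _ _ _ _
  t01 ct _ w1 _ _ _ _ _ (X j k)) => //.
- by rewrite subr_ge0.
- by rewrite norm_conjC.
- by rewrite mulrC -normCK w1 expr1n.
Qed.

End RotatedCompression.

(** * Quadratic forms, sign changes and transpositions *)

Section QuadraticForms.
Variables (C : numClosedFieldType) (M : nat).
Implicit Types (A : 'M[C]_M) (v x y : 'cV[C]_M) (a d : 'rV[C]_M).

Lemma qformD_parallelogram A x y :
  qform A (x + y) + qform A (x - y) = (qform A x + qform A y) *+ 2.
Proof.
rewrite /qform ctmxD ctmxB !mulmxBl !mulmxDl !mulmxBr !mulmxDr.
have add00 (P Q : 'M[C]_1) : (P + Q) 0 0 = P 0 0 + Q 0 0 by rewrite mxE.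
have opp00 (P : 'M[C]_1) : (- P) 0 0 = - P 0 0 by rewrite mxE.
by rewrite !(add00, opp00); ring.
Qed.

Lemma qformZ A v (s : C) : qform A (s *: v) = `|s| ^+ 2 * qform A v.
Proof.
by rewrite /qform ctmxZ -!scalemxAl -scalemxAr scalerA mxE normCK mulrC [s^* * s]mulrC mulrC.
Qed.

(** Perturbing [v] along [w = A v] gives the value [s^2 q(w) - 2 s |w|^2], which is negative for
    small [s > 0] unless [w = 0]. *)
Lemma psd_qform_eq0 A v : psd A -> qform A v = 0 -> A *m v = 0.
Proof.
move=> [hA pA] v0; apply/eqP; rewrite -qform1_eq0; set w := A *m v.
pose n := qform 1%:M w; pose c := qform A w.
have n0 : 0 <= n by rewrite /n qform1 sumr_ge0 // => i _; rewrite exprn_ge0.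
have c0 : 0 <= c by exact: pA.
have c1 : 0 < c + 1 by rewrite ltr_wpDl.
(* Dividing by [c + 1] instead of [c] keeps [s] informative when [c = 0]. *)
pose s := n / (c + 1).
have s0 : 0 <= s by rewrite divr_ge0 // ltW.
have sC : s^* = s by apply: CrealP; rewrite realE s0.
have : 0 <= s * s * c - s * n *+ 2.
  suff -> : s * s * c - s * n *+ 2 = qform A (v - s *: w) by exact: pA.
  rewrite /qform ctmxB ctmxZ sC !mulmxBl !mulmxBr -!scalemxAl -!scalemxAr.
  have E1 : (v^t* *m A *m v) 0 0 = 0 by exact: v0.
  have E2 : v^t* *m A *m w = w^t* *m w by rewrite /w ctmxM hA.
  have E3 : (w^t* *m w) 0 0 = n by rewrite /n /qform mulmx1.
  have E4 : w^t* *m A *m v = w^t* *m w by rewrite /w -mulmxA.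
  have sub00 (P Q : 'M[C]_1) : (P - Q) 0 0 = P 0 0 - Q 0 0 by rewrite !mxE.
  have scale00 (P : 'M[C]_1) : (s *: P) 0 0 = s * P 0 0 by rewrite !mxE.
  by rewrite !(sub00, scale00) E1 E2 E4 E3 -/(qform A w) -/c; ring.
have -> : s * s * c - s * n *+ 2 = - (n ^+ 2 * ((c + 2) / (c + 1) ^+ 2)).
  by rewrite /s; field; rewrite gt_eqF.
rewrite oppr_ge0 => n2; rewrite -/n.
have : n ^+ 2 * ((c + 2) / (c + 1) ^+ 2) == 0.
  by rewrite eq_le n2 mulr_ge0 ?exprn_ge0 // divr_ge0 ?exprn_ge0 // ltW // ltr_wpDl.
rewrite mulf_eq0 expf_eq0 /= => /orP[//|].
rewrite mulf_eq0 invr_eq0 expf_eq0 /= (gt_eqF c1) orbF.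
by rewrite gt_eqF // ltr_wpDl.
Qed.

Lemma diag_unitary a : (forall i, `|a 0 i| = 1) -> diag_mx a \is unitarymx.
Proof.
move=> a1; apply/unitarymxP/matrixP => i j.
rewrite mul_diag_mx !mxE eq_sym; case: eqP => [->|_].
  by rewrite !mulr1n -normCK a1 expr1n.
by rewrite !mulr0n rmorph0 mulr0.
Qed.

Lemma diag_conj_diag a d : (forall i, `|a 0 i| = 1) ->
  diag_mx a *m diag_mx d *m (diag_mx a)^t* = diag_mx d.
Proof.
move=> a1; rewrite [diag_mx a *m _]diag_mxC -mulmxA.
by rewrite (unitarymxP (diag_unitary a1)) mulmx1.
Qed.

Definition sign_flip (i : 'I_M) : 'rV[C]_M := \row_j (if j == i then -1 else 1).

Lemma norm_flip i j : `|sign_flip i 0 j| = 1.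
Proof. by rewrite mxE; case: eqP => _; rewrite ?normrN normr1. Qed.

Lemma flip_herm i : (diag_mx (sign_flip i))^t* = diag_mx (sign_flip i).
Proof.
apply/matrixP => x y; rewrite !mxE [y == x]eq_sym; have [->|_] := eqVneq x y.
  by rewrite !mulr1n; case: eqP; rewrite ?rmorphN rmorph1.
by rewrite !mulr0n rmorph0.
Qed.

Definition swap_mx (i j : 'I_M) : 'M[C]_M := perm_mx (tperm i j).

Lemma swap_ctmx i j : (swap_mx i j)^t* = swap_mx i j.
Proof. by rewrite /swap_mx tr_perm_mx tpermV map_perm_mx. Qed.

Lemma swap_unitary i j : swap_mx i j \is unitarymx.
Proof.
by apply/unitarymxP; rewrite swap_ctmx /swap_mx -perm_mxM tperm2 perm_mx1.
Qed.

Lemma swap_conjE i j A p q :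
  (swap_mx i j *m A *m (swap_mx i j)^t*) p q = A (tperm i j p) (tperm i j q).
Proof.
rewrite swap_ctmx /swap_mx -row_permE -[X in _ *m perm_mx X]tpermV -col_permE.
by rewrite !mxE.
Qed.

Lemma swap_diag d i j : d 0 i = d 0 j ->
  swap_mx i j *m diag_mx d *m (swap_mx i j)^t* = diag_mx d.
Proof.
move=> dij; apply/matrixP => x y; rewrite swap_conjE !mxE (inj_eq perm_inj).
by case: tpermP => [->|->|//]; rewrite dij.
Qed.

Lemma swap_delta i j : swap_mx i j *m delta_mx i 0 = delta_mx j 0 :> 'cV_M.
Proof.
rewrite -row_permE; apply/matrixP => x y; rewrite !mxE; congr ((_ && _)%:R).
by rewrite (can2_eq (tpermK i j) (tpermK i j)) tpermL.
Qed.

End QuadraticForms.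

(** * Compressed inverses with a vanishing diagonal entry *)

Section Degenerate.
Variables (C : numClosedFieldType) (L M : nat).
Implicit Types (F : 'M[C]_(L, M)) (d : 'rV[C]_M).

(* Holds for singular compressions as well, where [cinv] is junk. *)
Lemma cinv_diag_eq0 d F i j : (forall l, 0 <= d 0 l) -> d 0 j != 0 ->
  cinv (diag_mx d) F i i = 0 -> (F^t* *m F) j i = 0.
Proof.
move=> d0 dj; have pD := psd_diag d0.
have pH := psd_congr F pD; set H := _ *m F^t* in pH.
rewrite -qform_delta /cinv -/H; have [uH|nH] := boolP (H \in unitmx).
  rewrite -[X in _ *m _ *m X]trmxCK qform_congr trmxCK.
  move=> /(psd_qform_eq0 (psd_inv pH)) /(congr1 (mulmx H)).
  rewrite mulKVmx // mulmx0 => Fi0.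
  have -> : (F^t* *m F) j i = (F^t* *m (F *m delta_mx i (0 : 'I_1))) j 0.
    by rewrite mulmxA -colE [in RHS]mxE.
  by rewrite Fi0 mulmx0 mxE.
(* For a singular compression the default [invmx H = H] gives [Q D Q] with [Q = F^t* F]. Its form at
   [e_i] is that of [D] at [Q e_i], so [D Q e_i = 0], and [d_j] can be divided out. *)
rewrite invmx_out ?inE // /H !mulmxA -(mulmxA _ (F^t*)).
have hQ : (F^t* *m F)^t* = F^t* *m F by rewrite ctmxM trmxCK.
rewrite -{2}hQ qform_congr hQ => /(psd_qform_eq0 pD) /(congr1 (fun v : 'cV[C]_M => v j 0)).
rewrite mul_diag_mx -colE mxE [X in _ * X]mxE [RHS]mxE => /eqP.
by rewrite mulf_eq0 (negPf dj) => /eqP.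
Qed.

(** The projection [Q = F^t* F] has trace [L]. As column [i] vanishes off the diagonal, the common
    diagonal value [q] satisfies [q^2 = q], against [q M = L] with [0 < L < M]. *)
Lemma projection_not_scalar F i : (0 < L < M)%N -> F \is unitarymx ->
  (forall p, p != i -> (F^t* *m F) p i = 0) ->
  (forall p, (F^t* *m F) p p = (F^t* *m F) i i) -> False.
Proof.
move=> /andP[L0 LM] /unitarymxP uF off dia; set Q := F^t* *m F in off dia.
have QQ : Q *m Q = Q by rewrite /Q !mulmxA -(mulmxA _ F) uF mulmx1.
have q01 : Q i i * Q i i = Q i i.
  rewrite -[in RHS]QQ [RHS]mxE (bigD1 i) //= big1 ?addr0 // => p pi.
  by rewrite off // mulr0.
have trQ : Q i i *+ M = L%:R.
  rewrite -(mxtrace1 _ L) -uF mxtrace_mulC /mxtrace -/Q.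
  by rewrite (eq_bigr (fun=> Q i i)) // sumr_const card_ord.
have : (Q i i == 0) || (Q i i == 1).
  by rewrite -subr_eq0 -[X in _ || X]subr_eq0 subr0 -mulf_eq0 mulrBr mulr1 q01 subrr.
case/orP => /eqP Qi; move: trQ; rewrite Qi ?mul0rn => /eqP.
  by rewrite eq_sym pnatr_eq0 -leqn0 leqNgt L0.
by rewrite eqr_nat => /eqP ML; rewrite ML ltnn in LM.
Qed.

End Degenerate.

Section Nondegenerate.
Variables (C : numClosedFieldType) (L M : nat).
Implicit Types (F : 'M[C]_(L, M)) (d : 'rV[C]_M).

Lemma swap_delta_id i j k : k != i -> k != j ->
  swap_mx C i j *m delta_mx k 0 = delta_mx k 0 :> 'cV_M.
Proof.
move=> ki kj; rewrite -row_permE; apply/matrixP => x y; rewrite !mxE.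
by rewrite (can2_eq (tpermK i j) (tpermK i j)) tpermD // eq_sym.
Qed.

(** Only [d_j] is known to be nonzero, so each index [p] is exchanged with [j]. The swaps alone kill
    the entries [Q p i] of the projection; combined with a rotation by 45 degrees in the plane
    [(p, i)] they give [Q p p = Q i i], which [projection_not_scalar] excludes. *)
Lemma rotated_cinv_not_all_zero d F i j (c : C) : (0 < L < M)%N ->
  F \is unitarymx -> (forall l, 0 <= d 0 l) -> d 0 j != 0 -> j != i ->
  c^* = c -> c ^+ 2 * (1 + 1 ^+ 2) = 1 ->
  (forall p, p != i -> cinv (diag_mx d) (F *m swap_mx C j p) i i = 0) ->
  (forall p, p != i ->
     cinv (diag_mx d) (F *m (rotation p i c 1 1 *m swap_mx C j p)) i i = 0) ->
  False.
Proof.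
move=> LM uF d0 dj ji cC c2 h1 h2; have ij : i != j by rewrite eq_sym.
set Q := F^t* *m F.
have entry (T : 'M[C]_M) : cinv (diag_mx d) (F *m T) i i = 0 ->
    ((T *m delta_mx j (0 : 'I_1))^t* *m Q *m (T *m delta_mx i (0 : 'I_1))) 0 0 = 0.
  move=> /(cinv_diag_eq0 d0 dj) <-.
  by rewrite [RHS]mx_entryE !ctmxM !mulmxA.
have off p : p != i -> Q p i = 0.
  move=> pi; have ip : i != p by rewrite eq_sym.
  by have := entry _ (h1 p pi); rewrite swap_delta swap_delta_id // -mx_entryE.
apply: (projection_not_scalar LM uF off) => p.
have [->//|pi] := eqVneq p i; have ip : i != p by rewrite eq_sym.
have Qip : Q i p = 0.
  have hQ : Q^t* = Q by rewrite /Q ctmxM trmxCK.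
  by rewrite -hQ [LHS]mxE [X in Num.conj X]mxE off // rmorph0.
have := entry _ (h2 p pi); have Qpi := off p pi; rewrite -/Q.
clearbody Q; rewrite -!mulmxA swap_delta swap_delta_id // rotation_colj // rotation_colk //.
rewrite conjC1 !mulr1 !scale1r ctmxZ ctmxD !ctmx_delta cC -!scalemxAl -!scalemxAr.
rewrite scalerA mulmxA mulmxDl mulmxBr !mulmxDl -!rowE -!colE !mxE Qpi Qip.
have c0 : c * c != 0.
  by apply/eqP => c0; move: c2; rewrite expr2 c0 mul0r => /eqP; rewrite eq_sym oner_eq0.
move=> /eqP; rewrite mulf_eq0 (negPf c0) /= => /eqP e0.
by apply/eqP; rewrite -subr_eq0 -oppr_eq0 -e0; apply/eqP; ring.
Qed.

End Nondegenerate.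

(** * Regularization of the diagonal matrix by a positive shift *)

Section Regularization.
Variables (C : numClosedFieldType) (L M : nat).
Implicit Types (F : 'M[C]_(L, M)) (d : 'rV[C]_M).

Definition shift d (e : C) : 'rV[C]_M := d + const_mx e.

Lemma shiftE d e i : shift d e 0 i = d 0 i + e.
Proof. by rewrite !mxE. Qed.

Lemma qform_shift d e v :
  qform (diag_mx (shift d e)) v = qform (diag_mx d) v + e * qform 1%:M v.
Proof.
rewrite !qform_diag qform1 mulr_sumr -big_split; apply: eq_bigr => i _.
by rewrite shiftE mulrDl.
Qed.

Variable d : 'rV[C]_M.
Hypothesis d0 : forall i, 0 <= d 0 i.

Lemma shift_ge e i : e <= shift d e 0 i.
Proof. by rewrite shiftE lerDr. Qed.

Lemma shift_unit F e : F \is unitarymx -> 0 < e ->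
  F *m diag_mx (shift d e) *m F^t* \in unitmx.
Proof.
move=> uF e0; apply: (coercive_unit e0) => // v.
by apply: qform_diag_ge => i; exact: shift_ge.
Qed.

Lemma psd_shift e : 0 < e -> psd (diag_mx (shift d e)).
Proof. by move=> e0; apply: psd_diag => i; rewrite shiftE addr_ge0 // ltW. Qed.

Lemma cinv_diag_mx_le F j : d 0 j != 0 -> F *m diag_mx d *m F^t* \in unitmx ->
  cinv (diag_mx d) F j j <= (d 0 j)^-1.
Proof.
move=> dj uH; apply: cinv_diag_le => //; first exact: psd_diag.
  by rewrite lt_def dj d0.
move=> v; rewrite qform_diag (bigD1 j) //= lerDl.
by rewrite sumr_ge0 // => i _; rewrite mulr_ge0 // exprn_ge0.
Qed.

(** The default value of [invmx] makes this an entry of [Q D Q] for the projection [Q], whose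
    entries have modulus at most one. Singular compressions are thus bounded outright, and their
    probability never has to be computed. *)
Lemma cinv_singular_le F k : F \is unitarymx ->
  F *m diag_mx d *m F^t* \notin unitmx ->
  cinv (diag_mx d) F k k <= \sum_i d 0 i.
Proof.
move=> uF nH; rewrite -qform_delta /cinv invmx_out ?inE // !mulmxA -(mulmxA _ (F^t*)).
have hQ : (F^t* *m F)^t* = F^t* *m F by rewrite ctmxM trmxCK.
rewrite -{2}hQ qform_congr hQ qform_diag ler_sum // => i _.
rewrite ler_piMr // expr_le1 // -colE [X in `|X|]mxE.
(* [Q] is itself the compressed inverse of the identity, so the bound for coercive matrices applies
   with constant one. *)
have QE : F^t* *m F = cinv 1%:M F.
  by rewrite /cinv mulmx1 (unitarymxP uF) invmx1 mulmx1.
rewrite QE -[X in _ <= X]invr1; apply: cinv_entry_le => //.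
- by rewrite -diag_const_mx; apply: psd_diag => l; rewrite mxE.
- by move=> v; rewrite mul1r.
Qed.

Lemma cinv_le_of_neq0 F j : F \is unitarymx -> d 0 j != 0 ->
  cinv (diag_mx d) F j j <= \sum_i d 0 i + (d 0 j)^-1.
Proof.
move=> uF dj; have [uH|nH] := boolP (F *m diag_mx d *m F^t* \in unitmx).
  by rewrite ler_wpDl ?sumr_ge0 // cinv_diag_mx_le.
by rewrite ler_wpDr ?invr_ge0 // cinv_singular_le.
Qed.

(* On an invertible compression [H] this is [cinv_variational] for the shifted
   matrix at the optimal vector [H^-1 F e_k] of the unshifted one. *)
Lemma cinv_le_shift F k : F \is unitarymx -> exists m : C, 0 <= m /\
  forall e, 0 < e -> cinv (diag_mx d) F k k
    <= \sum_i d 0 i + cinv (diag_mx (shift d e)) F k k + e * m.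
Proof.
move=> uF; have pD := psd_diag d0.
have X0 e : 0 < e -> 0 <= cinv (diag_mx (shift d e)) F k k.
  by move=> e0; exact/psd_diag_ge0/psd_cinv/psd_shift.
have [uH|nH] := boolP (F *m diag_mx d *m F^t* \in unitmx); last first.
  exists 0; split=> // e e0; rewrite mulr0 addr0 ler_wpDr ?X0 //.
  exact: cinv_singular_le.
set H := _ *m F^t* in uH; pose z : 'cV[C]_L := invmx H *m (F *m delta_mx k 0).
exists (qform 1%:M (F^t* *m z)); split.
  by rewrite qform1 sumr_ge0 // => i _; rewrite exprn_ge0.
move=> e e0; rewrite -addrA ler_wpDl ?sumr_ge0 // -lerBlDr.
have := cinv_variational z (delta_mx k 0) (psd_shift e0) (shift_unit uF e0).
rewrite qform_delta qform_shift opprD addrA.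
have hH : H^t* = H by case: (psd_congr F pD).
have z1 : (z^t* *m (F *m delta_mx k (0 : 'I_1))) 0 0 = cinv (diag_mx d) F k k.
  rewrite (mx_entryE (cinv _ _)) /cinv /z. rewrite !ctmxM. rewrite ctmx_inv hH -/H.
  by rewrite !mulmxA.
have z2 : qform (diag_mx d) (F^t* *m z) = cinv (diag_mx d) F k k.
  have Hz : H *m z = F *m delta_mx k 0 by rewrite mulKVmx.
  by rewrite -qform_congr -/H -z1 /qform -mulmxA Hz.
have zC : (cinv (diag_mx d) F k k)^* = cinv (diag_mx d) F k k.
  by apply: CrealP; rewrite realE psd_diag_ge0 //; exact: psd_cinv.
by rewrite z1 z2 zC addrK.
Qed.

Lemma sum_cinv_shift_le F e : F \is unitarymx -> 0 < e ->
  \sum_j d 0 j * cinv (diag_mx (shift d e)) F j j <= L%:R.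
Proof.
move=> uF e0; rewrite -(trace_cinv (shift_unit uF e0)) /mxtrace ler_sum // => j _.
rewrite mul_mx_diag [X in _ <= X]mxE mulrC ler_wpM2l //.
  exact/psd_diag_ge0/psd_cinv/psd_shift.
by rewrite shiftE lerDl ltW.
Qed.

Lemma cinv_shift_le F e j : F \is unitarymx -> 0 < e -> d 0 j != 0 ->
  cinv (diag_mx (shift d e)) F j j <= (d 0 j)^-1.
Proof.
move=> uF e0 dj; have dj0 : 0 < d 0 j by rewrite lt_def dj d0.
apply: cinv_diag_le => //; [exact: psd_shift|exact: shift_unit|].
move=> v; rewrite qform_shift qform_diag (bigD1 j) //= -addrA lerDl.
apply: addr_ge0; first by rewrite sumr_ge0 // => i _; rewrite mulr_ge0 // exprn_ge0.
by rewrite mulr_ge0 ?(ltW e0) // qform1 sumr_ge0 // => i _; rewrite exprn_ge0.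
Qed.

End Regularization.

Lemma rank_diag_mx (F : fieldType) n (a : 'rV[F]_n) :
  \rank (diag_mx a) = #|[pred i : 'I_n | a 0%R i != 0%R]|.
Proof.
rewrite -sum1_card big_mkcond /=.
elim: n a => [|n ih] a; first by rewrite big_ord0 [diag_mx a]flatmx0 mxrank0.
rewrite big_ord_recl.
have -> : \rank (diag_mx a) = (\rank (diag_mx (lsubmx (a : 'rV_(1 + n))))
   + \rank (diag_mx (rsubmx (a : 'rV_(1 + n)))))%N.
  by rewrite -rank_diag_block_mx -diag_mx_row hsubmxK.
rewrite ih rank_rV; congr (_ + _)%N.
  rewrite inE; have -> : (diag_mx (lsubmx (a : 'rV_(1 + n))) != 0) = (a 0 ord0 != 0).
    congr (~~ _); apply/eqP/eqP => [/matrixP/(_ 0 0)|a0].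
      by rewrite !mxE mulr1n => <-; congr (a _ _); exact: val_inj.
    apply/matrixP => x y; rewrite !ord1 !mxE (_ : lshift n 0 = ord0) ?a0 ?mul0rn //.
    exact: val_inj.
  by case: (_ != _).
apply: eq_bigr => i _; rewrite !inE mxE.
by rewrite (_ : rshift 1 i = lift ord0 i) //; exact: val_inj.
Qed.


Local Open Scope complex_scope.
Local Open Scope sesquilinear_scope.

(** * Measurability and invariant integration *)

Section ComplexMeasurable.
Context d (T : measurableType d) (R : realType).
Implicit Types f g : T -> R[i].

Definition cmeasurable f :=
  measurable_fun setT (fun x => complex.Re (f x)) /\
  measurable_fun setT (fun x => complex.Im (f x)).

Lemma cmeasurable_cst (a : R[i]) : cmeasurable (fun=> a).
Proof. by split; exact: measurable_cst. Qed.

Lemma cmeasurableD f g : cmeasurable f -> cmeasurable g ->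
  cmeasurable (fun x => f x + g x).
Proof.
move=> [f1 f2] [g1 g2]; split.
- apply: eq_measurable_fun (measurable_funD f1 g1) => x _ /=.
  by case: (f x) (g x) => ? ? [].
- apply: eq_measurable_fun (measurable_funD f2 g2) => x _ /=.
  by case: (f x) (g x) => ? ? [].
Qed.

Lemma cmeasurableM f g : cmeasurable f -> cmeasurable g ->
  cmeasurable (fun x => f x * g x).
Proof.
move=> [f1 f2] [g1 g2]; split.
- apply: eq_measurable_fun
    (measurable_funB (measurable_funM f1 g1) (measurable_funM f2 g2)) => x _ /=.
  by case: (f x) (g x) => ? ? [].
- apply: eq_measurable_fun
    (measurable_funD (measurable_funM f1 g2) (measurable_funM f2 g1)) => x _ /=.
  by case: (f x) (g x) => ? ? [].
Qed.

Lemma cmeasurable_conj f : cmeasurable f -> cmeasurable (fun x => Num.conj (f x)).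
Proof.
move=> [f1 f2]; split.
- by apply: eq_measurable_fun f1 => x _ /=; case: (f x).
- apply: eq_measurable_fun (measurable_funN f2) => x _ /=.
  by case: (f x).
Qed.

Lemma cmeasurableV f : cmeasurable f -> cmeasurable (fun x => (f x)^-1).
Proof.
move=> [f1 f2].
pose n x := (complex.Re (f x) ^+ 2 + complex.Im (f x) ^+ 2) `^ -1.
have mn : measurable_fun setT n.
  apply: (measurableT_comp (measurable_powR _)).
  by apply: measurable_funD; exact: measurable_funX.
have nE x : n x = (complex.Re (f x) ^+ 2 + complex.Im (f x) ^+ 2)^-1.
  by rewrite /n powR_inv1 // addr_ge0 // sqr_ge0.
split.
- apply: eq_measurable_fun (measurable_funM f1 mn) => x _ /=.
  by rewrite nE; case: (f x).
- apply: eq_measurable_fun (measurable_funN (measurable_funM f2 mn)) => x _ /=.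
  by rewrite nE; case: (f x).
Qed.

Lemma cmeasurable_sum I (r : seq I) (P : pred I) (F : I -> T -> R[i]) :
  (forall i, cmeasurable (F i)) -> cmeasurable (fun x => \sum_(i <- r | P i) F i x).
Proof.
move=> mF; elim: r => [|i r ih].
  by under eq_fun do rewrite big_nil; exact: cmeasurable_cst.
under eq_fun do rewrite big_cons.
by case: (P i) => //; exact: cmeasurableD.
Qed.

Lemma cmeasurable_prod I (r : seq I) (P : pred I) (F : I -> T -> R[i]) :
  (forall i, cmeasurable (F i)) -> cmeasurable (fun x => \prod_(i <- r | P i) F i x).
Proof.
move=> mF; elim: r => [|i r ih].
  by under eq_fun do rewrite big_nil; exact: cmeasurable_cst.
under eq_fun do rewrite big_cons.
by case: (P i) => //; exact: cmeasurableM.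
Qed.

Lemma measurable_fun_ceq f g : cmeasurable f -> cmeasurable g ->
  measurable_fun setT (fun x => f x == g x).
Proof.
move=> [f1 f2] [g1 g2].
apply: eq_measurable_fun (measurable_and (measurable_fun_eqr f1 g1)
  (measurable_fun_eqr f2 g2)) => x _ /=.
by rewrite eq_complex.
Qed.

Lemma cmeasurable_if (b : T -> bool) f g : measurable_fun setT b ->
  cmeasurable f -> cmeasurable g -> cmeasurable (fun x => if b x then f x else g x).
Proof.
move=> mb [f1 f2] [g1 g2]; split.
- apply: eq_measurable_fun (measurable_fun_ifT mb f1 g1) => x _ /=.
  by case: (b x).
- apply: eq_measurable_fun (measurable_fun_ifT mb f2 g2) => x _ /=.
  by case: (b x).
Qed.

Definition mxmeasurable m n (F : T -> 'M[R[i]]_(m, n)) :=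
  forall i j, cmeasurable (fun x => F x i j).

Lemma mxmeasurable_cst m n (A : 'M[R[i]]_(m, n)) : mxmeasurable (fun=> A).
Proof. by move=> i j; exact: cmeasurable_cst. Qed.

Lemma mxmeasurableM m n p (F : T -> 'M[R[i]]_(m, n)) (G : T -> 'M[R[i]]_(n, p)) :
  mxmeasurable F -> mxmeasurable G -> mxmeasurable (fun x => F x *m G x).
Proof.
move=> mF mG i j; under eq_fun do rewrite mxE.
by apply: cmeasurable_sum => k; exact: cmeasurableM.
Qed.

Lemma mxmeasurable_ctmx m n (F : T -> 'M[R[i]]_(m, n)) :
  mxmeasurable F -> mxmeasurable (fun x => (F x)^t*).
Proof.
by move=> mF i j; under eq_fun do rewrite !mxE; exact: cmeasurable_conj.
Qed.

Lemma cmeasurable_det n (F : T -> 'M[R[i]]_n) :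
  mxmeasurable F -> cmeasurable (fun x => \det (F x)).
Proof.
move=> mF; apply: cmeasurable_sum => s; apply: cmeasurableM.
  exact: cmeasurable_cst.
by apply: cmeasurable_prod => i; exact: mF.
Qed.

Lemma mxmeasurable_inv n (F : T -> 'M[R[i]]_n) :
  mxmeasurable F -> mxmeasurable (fun x => invmx (F x)).
Proof.
move=> mF i j.
(* Cramer's rule off the zero set of the determinant, and the default value [F x] on it. *)
have -> : (fun x => invmx (F x) i j) = (fun x => if \det (F x) == 0 then F x i j
    else (\det (F x))^-1 * cofactor (F x) j i).
  apply/funext => x; rewrite /invmx unitmxE unitfE.
  by case: eqP => _ //=; rewrite !mxE.
have mdet := cmeasurable_det mF.
apply: cmeasurable_if; [|exact: mF|].
  by apply: measurable_fun_ceq => //; exact: cmeasurable_cst.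
apply: cmeasurableM; first exact: cmeasurableV.
apply: cmeasurableM; first exact: cmeasurable_cst.
by apply: cmeasurable_det => a b; under eq_fun do rewrite !mxE; exact: mF.
Qed.

End ComplexMeasurable.

(** * Measurability and invariance on the Stiefel manifold *)

Section Stiefel.
Context {R : realType} {L M : nat}.
Notation cmx := (cmatrix R L M).

Lemma mxmeasurable_coord : mxmeasurable (fun F : cmx => (F : 'M[R[i]]_(L, M))).
Proof.
move=> i j; split=> _ B mB; rewrite setTI; apply: sub_sigma_algebra;
  exists i, j, B; split => //.
- by left.
- by right.
Qed.

Lemma measurable_to_cmatrix d (T : measurableType d) (f : T -> 'M[R[i]]_(L, M)) :
  mxmeasurable f -> measurable_fun setT (f : T -> cmx).
Proof.
move=> mf; apply: (@measurability _ _ T cmx setT f (@mx_coord_sets R L M)) => //.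
move=> _ [_ [i [j [B [mB [->|->]]]]] <-].
- exact: (mf i j).1.
- exact: (mf i j).2.
Qed.

Lemma measurable_mulmxr (U : 'M[R[i]]_M) :
  measurable_fun setT ((fun F : cmx => F *m U) : cmx -> cmx).
Proof.
apply: measurable_to_cmatrix.
exact: (mxmeasurableM mxmeasurable_coord (@mxmeasurable_cst _ cmx R _ _ U)).
Qed.

Lemma mxmeasurable_cinv (A : 'M[R[i]]_M) : mxmeasurable (fun F : cmx => cinv A F).
Proof.
have mF := mxmeasurable_coord; have mFt := mxmeasurable_ctmx mF.
apply: mxmeasurableM => //; apply: mxmeasurableM => //; apply: mxmeasurable_inv.
by apply: mxmeasurableM => //; apply: mxmeasurableM => //; exact: mxmeasurable_cst.
Qed.

Definition stiefel : set cmx := [set F | (F : 'M[R[i]]_(L, M)) \is unitarymx].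

Lemma measurable_stiefel : measurable stiefel.
Proof.
have -> : stiefel = \bigcap_(x in [set: 'I_L * 'I_L])
    [set F : cmx | ((F : 'M[R[i]]_(L, M)) *m F^t*) x.1 x.2 == (1%:M : 'M[R[i]]_L) x.1 x.2].
  apply/seteqP; split => [F /unitarymxP F1 x _ /=|F F1]; first by rewrite F1.
  by apply/unitarymxP/matrixP => i j; apply/eqP; exact: (F1 (i, j)).
apply: fin_bigcap_measurable; first exact: finite_finset.
move=> x _; rewrite -[X in measurable X]setTI.
apply: (measurable_fun_ceq (f := fun F : cmx => _) (g := fun=> _) _ _ measurableT (Y := [set true])) => //.
apply: mxmeasurableM; first exact: mxmeasurable_coord.
exact/mxmeasurable_ctmx/mxmeasurable_coord.
Qed.

Lemma stiefel_mulmx (U : 'M[R[i]]_M) (F : cmx) : U \is unitarymx ->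
  stiefel (F *m U) = stiefel F.
Proof.
by move=> uU; rewrite /stiefel /= unitary_mulmxr.
Qed.

Variable P : probability cmx R.
Hypothesis haarP : haar_stiefel P.

Lemma haar_stiefelC : P (~` stiefel) = 0%E.
Proof.
by rewrite probability_setC ?haarP.1 ?subee //; exact: measurable_stiefel.
Qed.

Lemma haar_pushforward (U : 'M[R[i]]_M) (D : set cmx) (f : cmx -> \bar R) :
  U \is unitarymx ->
  (\int[pushforward P (fun F : cmx => F *m U : cmx)]_(F in D) f F
    = \int[P]_(F in D) f F)%E.
Proof.
move=> uU; apply: eq_measure_integral => [|mU B mB _].
  exact: measurable_mulmxr.
exact: (haarP.2 U uU B mB).
Qed.

Lemma haar_ge0_integral (U : 'M[R[i]]_M) (f : cmx -> \bar R) :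
  U \is unitarymx -> measurable_fun setT f -> (forall F, 0 <= f F)%E ->
  (\int[P]_F f (F *m U) = \int[P]_F f F)%E.
Proof.
move=> uU mf f0; rewrite -[RHS](haar_pushforward _ _ uU).
by rewrite ge0_integral_pushforward //; exact: measurable_mulmxr.
Qed.

Lemma haar_integrable (U : 'M[R[i]]_M) (f : cmx -> R) :
  U \is unitarymx -> P.-integrable setT (EFin \o f) ->
  P.-integrable setT (fun F => (f (F *m U))%:E).
Proof.
move=> uU /integrableP[mf fi]; apply/integrableP; split.
  exact: (measurableT_comp mf (measurable_mulmxr U)).
apply: le_lt_trans fi; rewrite le_eqVlt; apply/orP; left; apply/eqP.
apply: (@haar_ge0_integral U (fun F => `|(f F)%:E|%E)) => //.
exact: measurableT_comp.
Qed.

Lemma haar_integral (U : 'M[R[i]]_M) (f : cmx -> R) :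
  U \is unitarymx -> P.-integrable setT (EFin \o f) ->
  (\int[P]_F (f (F *m U))%:E = \int[P]_F (f F)%:E)%E.
Proof.
move=> uU fi; have fiU := haar_integrable uU fi.
rewrite -[RHS](haar_pushforward _ _ uU).
rewrite (integral_pushforward (measurable_mulmxr U)) //.
by have /integrableP[] := fi.
Qed.

End Stiefel.

Lemma double_ereal_inj (R : realType) (x y : \bar R) : (x + x = y + y -> x = y)%E.
Proof.
case: x y => [x| |] [y| |] //=; rewrite -?EFinD => -[] // xy; congr (_%:E); lra.
Qed.

Lemma RealD (R : realType) (x y : R[i]) :
  complex.Re (x + y) = complex.Re x + complex.Re y.
Proof. by case: x y => ? ? []. Qed.

Lemma ImagD (R : realType) (x y : R[i]) :
  complex.Im (x + y) = complex.Im x + complex.Im y.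
Proof. by case: x y => ? ? []. Qed.

Lemma RealM_real (R : realType) (x y : R[i]) : 0 <= x ->
  complex.Re (x * y) = complex.Re x * complex.Re y.
Proof.
move=> /ger0_Im; case: x y => a b [c e] /= ->; by rewrite mul0r subr0.
Qed.

Lemma Real_ge0 (R : realType) (x : R[i]) : 0 <= x -> 0 <= complex.Re x.
Proof. by rewrite lecE => /andP[]. Qed.

(** * Expected quadratic forms *)

Section InvcovForm.
Context {R : realType} {L M : nat}.
Notation cmx := (cmatrix R L M).
Variable P : probability cmx R.
Implicit Types (A U : 'M[R[i]]_M) (v : 'cV[R[i]]_M).

Definition form_at A v (F : cmx) : R := complex.Re (qform (cinv A F) v).

Lemma invcov_formE A v : invcov_form P A v = (\int[P]_F (form_at A v F)%:E)%E.
Proof. by rewrite /invcov_form unlock. Qed.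

Lemma measurable_form_at A v : measurable_fun setT (form_at A v).
Proof.
have mX := mxmeasurable_cinv (L := L) A.
have mv := @mxmeasurable_cst _ cmx R _ _ v.
have mvt := @mxmeasurable_cst _ cmx R _ _ (v^t*).
exact: (mxmeasurableM (mxmeasurableM mvt mX) mv 0 0).1.
Qed.

Lemma form_at_ge0 A v F : psd A -> 0 <= form_at A v F.
Proof. by move=> pA; apply/Real_ge0/(psd_cinv F pA).2. Qed.

Lemma form_at_mulr A v F U : U \is unitarymx ->
  form_at A (U^t* *m v) (F *m U) = form_at (U *m A *m U^t*) v F.
Proof.
move=> uU; rewrite /form_at cinv_mulr -[X in _ *m X]trmxCK qform_congr trmxCK.
by rewrite mulmxA (unitarymxP uU) mul1mx.
Qed.

Hypothesis haarP : haar_stiefel P.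

Lemma invcov_form_conj A U v : psd A -> U \is unitarymx ->
  invcov_form P (U *m A *m U^t*) v = invcov_form P A (U^t* *m v).
Proof.
move=> pA uU; rewrite !invcov_formE -[RHS](haar_ge0_integral haarP uU).
- by apply: eq_integral => F _; rewrite form_at_mulr.
- by apply/measurable_EFinP; exact: measurable_form_at.
- by move=> F; rewrite lee_fin form_at_ge0.
Qed.

Lemma invcov_form_ge0 A v : psd A -> (0 <= invcov_form P A v)%E.
Proof.
move=> pA; rewrite invcov_formE; apply: integral_ge0 => F _.
by rewrite lee_fin form_at_ge0.
Qed.

(** All terms are nonnegative, so the law survives in [[0, +oo]], where the cross terms of a
    sesquilinear expansion might not be integrable; it stands in for that expansion. *)
Lemma invcov_form_parallelogram A x y : psd A ->
  (invcov_form P A (x + y)%R + invcov_form P A (x - y)%R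
   = (invcov_form P A x + invcov_form P A y)
     + (invcov_form P A x + invcov_form P A y))%E.
Proof.
move=> pA; rewrite !invcov_formE.
have mE v : measurable_fun setT (fun F => (form_at A v F)%:E).
  by apply/measurable_EFinP; exact: measurable_form_at.
have gE v (F : cmx) : setT F -> (0 <= (form_at A v F)%:E)%E.
  by move=> _; rewrite lee_fin form_at_ge0.
have mD v w : measurable_fun setT (fun F => (form_at A v F)%:E + (form_at A w F)%:E)%E.
  exact: emeasurable_funD.
have gD v w (F : cmx) : setT F -> (0 <= (form_at A v F)%:E + (form_at A w F)%:E)%E.
  by move=> FT; apply: adde_ge0; exact: gE.
rewrite -!ge0_integralD //; [|by move=> F FT; first [exact: gD|exact: gE]..].
apply: eq_integral => F _; congr (_%:E); rewrite /form_at -!RealD.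
by rewrite qformD_parallelogram.
Qed.

Lemma invcov_formZ A v (s : R[i]) : psd A ->
  invcov_form P A (s *: v) = ((complex.Re (`|s| ^+ 2)%R)%:E * invcov_form P A v)%E.
Proof.
move=> pA; rewrite !invcov_formE.
have s0 : 0 <= `|s| ^+ 2 by rewrite exprn_ge0.
rewrite -ge0_integralZl_EFin //.
- by apply: eq_integral => F _; rewrite /form_at qformZ RealM_real.
- by move=> F _; rewrite lee_fin form_at_ge0.
- by apply/measurable_EFinP; exact: measurable_form_at.
- exact: Real_ge0.
Qed.

Lemma invcov_form0 A : invcov_form P A 0 = 0%E.
Proof.
rewrite invcov_formE; apply: integral0_eq => F _.
by rewrite /form_at /qform mulmx0 mxE.
Qed.

Variable d : 'rV[R[i]]_M.
Hypothesis d0 : forall i, 0 <= d 0 i.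

(** The sign change of coordinate [i] commutes with the diagonal matrix and maps [z + s e_i] to
    [z - s e_i]. The two terms on the left of the parallelogram law thus agree, and halving gives
    additivity. *)
Lemma invcov_form_add_coord (z : 'cV[R[i]]_M) i (s : R[i]) : z i 0 = 0 ->
  invcov_form P (diag_mx d) (z + s *: delta_mx i 0) =
  (invcov_form P (diag_mx d) z
   + invcov_form P (diag_mx d) (s *: delta_mx i 0)%R)%E.
Proof.
move=> zi; apply: double_ereal_inj; rewrite -invcov_form_parallelogram; last exact: psd_diag.
congr (_ + _)%E; have nf := norm_flip R[i] i.
rewrite -{1}(diag_conj_diag d nf) invcov_form_conj; first last.
- exact: diag_unitary.
- exact: psd_diag.
congr (invcov_form _ _ _); rewrite flip_herm mul_diag_mx.
apply/matrixP => x y; rewrite (ord1 y) !mxE; case: eqP => [->|_] /=.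
  by rewrite zi; ring.
by ring.
Qed.

Lemma invcov_form_diag v : invcov_form P (diag_mx d) v =
  (\sum_(i < M) (complex.Re (`|v i 0%R| ^+ 2)%R)%:E
                 * invcov_form P (diag_mx d) (delta_mx i 0%R))%E.
Proof.
have vE : v = \sum_i v i 0 *: delta_mx i 0.
  by rewrite {1}[v]matrix_sum_delta; apply: eq_bigr => i _; rewrite big_ord1.
(* The list of indices is duplicate-free, so the partial sum has no component along the next basis
   vector. *)
rewrite {1}vE; have := index_enum_uniq 'I_M.
elim: (index_enum _) => [|i r ih]; first by rewrite !big_nil invcov_form0.
rewrite !big_cons => /andP[ir ur].
rewrite addrC invcov_form_add_coord; last first.
  rewrite summxE big_seq big1 // => j jr; rewrite !mxE.
  by case: eqP => [ij|_]; rewrite ?mulr0 //; rewrite ij jr in ir.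
by rewrite ih // addeC invcov_formZ //; exact: psd_diag.
Qed.

Lemma invcov_form_swap i j : d 0 i = d 0 j ->
  invcov_form P (diag_mx d) (delta_mx i 0) = invcov_form P (diag_mx d) (delta_mx j 0).
Proof.
move=> dij; rewrite -{1}(swap_diag dij).
rewrite (invcov_form_conj _ (psd_diag d0) (swap_unitary R[i] i j)).
by rewrite swap_ctmx swap_delta.
Qed.

Lemma integral_stiefel_gt0 (f : cmx -> R) : measurable_fun setT f ->
  (forall F, 0 <= f F) -> (forall F, stiefel F -> f F != 0) ->
  (0 < \int[P]_F (f F)%:E)%E.
Proof.
move=> mf f0 fS; have mE : measurable_fun setT (fun F => (f F)%:E).
  exact/measurable_EFinP.
rewrite lt0e integral_ge0 ?andbT; last by move=> F _; rewrite lee_fin.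
apply/eqP => f_int0.
have : ae_eq P setT (EFin \o f) (cst 0%E).
  apply/ae_eq_integral_abs => //; rewrite -f_int0; apply: eq_integral => F _ /=.
  by rewrite ger0_norm.
move=> [N [mN N0 subN]].
have : (P stiefel <= P N)%E.
  apply: le_measure; rewrite ?inE //; first exact: measurable_stiefel.
  move=> F SF; apply: subN => /= /(_ I) [] fF; move: (fS F SF).
  by rewrite fF eqxx.
by rewrite haarP.1 N0 lee_fin ler10.
Qed.

End InvcovForm.

(** * Positivity of the expected diagonal *)

Section Positivity.
Context {R : realType} {L M : nat}.
Notation cmx := (cmatrix R L M).
Variable P : probability cmx R.
Hypothesis haarP : haar_stiefel P.

Lemma form_at_delta_eq0 (A : 'M[R[i]]_M) i (F : cmx) : psd A ->
  form_at A (delta_mx i 0) F = 0 -> cinv A F i i = 0.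
Proof.
move=> pA; rewrite /form_at qform_delta; have := psd_diag_ge0 i (psd_cinv F pA).
by move=> /ger0_Im; case: (cinv _ _ _ _) => a b /= -> ->.
Qed.

(** By invariance a zero integral would persist after each of finitely many unitary changes of [F].
    Their sum [G] would have zero integral too, although [rotated_cinv_not_all_zero] makes it
    positive everywhere on the Stiefel manifold. *)
Lemma invcov_form_delta_gt0 (d : 'rV[R[i]]_M) i j : (0 < L < M)%N ->
  (forall l, 0 <= d 0 l) -> d 0 j != 0 -> j != i ->
  (0 < invcov_form P (diag_mx d) (delta_mx i 0%R))%E.
Proof.
move=> LM d0 dj ji; have pD := psd_diag d0.
set A := diag_mx d in pD *; set e : 'cV[R[i]]_M := delta_mx i 0.
rewrite lt0e invcov_form_ge0 // andbT; apply/negP => /eqP.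
rewrite invcov_formE => int0.
(* The cosine of 45 degrees, for a rotation of tangent one. *)
pose c : R[i] := (sqrtC 2)^-1.
have c0 : 0 <= c by rewrite invr_ge0 sqrtC_ge0.
have cC : Num.conj c = c by apply: CrealP; rewrite realE c0.
have c2 : c ^+ 2 * (1 + 1 ^+ 2) = 1.
  by rewrite exprVn sqrtCK expr1n mulVf // pnatr_eq0.
pose T1 p := swap_mx R[i] j p.
pose T2 p := rotation p i c 1 1 *m swap_mx R[i] j p.
have uT1 p : T1 p \is unitarymx by exact: swap_unitary.
have uT2 p : p != i -> T2 p \is unitarymx.
  move=> pi; apply: mul_unitarymx; last exact: swap_unitary.
  by apply: rotation_unitary => //; rewrite ?conjC1 ?normr1.
have degenerate (F : cmx) : stiefel F ->
    (forall p, p != i -> form_at A e (F *m T1 p) = 0 /\ form_at A e (F *m T2 p) = 0) ->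
    False.
  move=> uF hz; apply: (rotated_cinv_not_all_zero LM uF d0 dj ji cC c2) => p /hz[z1 z2].
    exact: form_at_delta_eq0 z1.
  exact: form_at_delta_eq0 z2.
have mh : measurable_fun setT (form_at A e : cmx -> R) by exact: measurable_form_at.
have h0 (F : cmx) : 0 <= form_at A e F by exact: form_at_ge0.
move: (form_at A e : cmx -> R) T1 T2 uT1 uT2 degenerate mh h0 int0.
move=> h T1 T2 uT1 uT2 degenerate mh h0 int0.
have mhU (U : 'M[R[i]]_M) : measurable_fun setT (fun F : cmx => h (F *m U)).
  exact: (measurableT_comp mh (measurable_mulmxr U)).
have ih (U : 'M[R[i]]_M) : U \is unitarymx -> (\int[P]_F (h (F *m U))%:E = 0)%E.
  move=> uU; rewrite -int0; apply: (haar_ge0_integral haarP uU) => //.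
  exact/measurable_EFinP.
pose r := [seq p <- enum 'I_M | p != i].
have rP p : (p \in r) = (p != i) by rewrite mem_filter mem_enum andbT.
pose G (F : cmx) := \sum_(p <- r) (h (F *m T1 p) + h (F *m T2 p)).
have mG : measurable_fun setT G.
  apply: measurable_sum => p; exact: measurable_funD.
have G0 F : 0 <= G F by apply: sumr_ge0 => p _; exact: addr_ge0.
have GS F : stiefel F -> G F != 0.
  move=> uF; apply/eqP => GF0; apply: (degenerate F uF) => p pi.
  have /eqP := GF0; rewrite psumr_eq0; last by move=> q _; exact: addr_ge0.
  move=> /allP /(_ p); rewrite rP pi => /(_ isT) /=; rewrite paddr_eq0 //.
  by case/andP => /eqP ? /eqP.
have := integral_stiefel_gt0 haarP mG G0 GS.
suff -> : (\int[P]_F (G F)%:E = 0)%E by rewrite ltxx.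
rewrite /G; under eq_integral do rewrite -sumEFin.
rewrite ge0_integral_sum //.
- rewrite big_seq big1 // => p; rewrite rP => pi.
  under eq_integral do rewrite EFinD.
  rewrite ge0_integralD // ?ih ?adde0 //; try exact: uT2.
  + by move=> F _; rewrite lee_fin.
  + by apply/measurable_EFinP.
  + by move=> F _; rewrite lee_fin.
  + by apply/measurable_EFinP.
- by move=> p; apply/measurable_EFinP; exact: measurable_funD.
- by move=> p F _; rewrite lee_fin addr_ge0.
Qed.

End Positivity.

(** * Integrability of the compressed inverse *)

Section BoundedExpectation.
Context {R : realType} {L M : nat}.
Notation cmx := (cmatrix R L M).
Variable P : probability cmx R.
Hypothesis haarP : haar_stiefel P.
Implicit Types g h : cmx -> R.

(* Bounds on compressed inverses hold only on the Stiefel manifold, so random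
   variables are cut off to [0] outside of it. *)
Definition cutoff g (F : cmx) : R :=
  if (F : 'M[R[i]]_(L, M)) \is unitarymx then g F else 0.

Lemma measurable_cutoff g :
  measurable_fun setT g -> measurable_fun setT (cutoff g).
Proof.
move=> mg; apply: measurable_fun_ifT => //.
apply: (measurable_fun_bool true); rewrite setTI.
by have := @measurable_stiefel R L M; congr measurable; apply/seteqP; split.
Qed.

Definition sbounded g := measurable_fun setT g /\
  exists K, forall F, stiefel F -> `|g F| <= K.

Lemma sboundedM g h : sbounded g -> sbounded h -> sbounded (fun F => g F * h F).
Proof.
move=> [mg [K gK]] [mh [H hH]]; split; first exact: measurable_funM.
by exists (K * H) => F SF; rewrite normrM ler_pM // ?gK ?hH.
Qed.

Lemma sboundedD g h : sbounded g -> sbounded h -> sbounded (fun F => g F + h F).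
Proof.
move=> [mg [K gK]] [mh [H hH]]; split; first exact: measurable_funD.
exists (K + H) => F SF; rewrite (le_trans (ler_normD _ _)) // lerD ?gK ?hH //.
Qed.

Lemma sbounded_cst a : sbounded (fun=> a).
Proof. by split; [exact: measurable_cst|exists `|a|]. Qed.

Lemma sboundedB g h : sbounded g -> sbounded h -> sbounded (fun F => g F - h F).
Proof.
move=> bg bh; apply: sboundedD => //.
have -> : (fun F => - h F) = (fun F => -1 * h F) by apply/funext => F; rewrite mulN1r.
by apply: sboundedM => //; exact: sbounded_cst.
Qed.

Lemma sbounded_sum I (r : seq I) (G : I -> cmx -> R) :
  (forall i, sbounded (G i)) -> sbounded (fun F => \sum_(i <- r) G i F).
Proof.
move=> bG; elim: r => [|i r ih].
  by under eq_fun do rewrite big_nil; exact: sbounded_cst.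
by under eq_fun do rewrite big_cons; exact: sboundedD.
Qed.

Lemma sbounded_integrable g : sbounded g -> P.-integrable setT (EFin \o cutoff g).
Proof.
move=> [mg [K gK]]; apply: measurable_bounded_integrable => //.
- by rewrite [X in (X < _)%E](@probability_setT _ _ _ P) ltry.
- exact: measurable_cutoff.
exists K; split; first exact: num_real.
move=> x Kx F _; rewrite /= /cutoff; case: ifPn => [uF|_].
  exact: le_trans (gK F uF) (ltW Kx).
(* [K] must be nonnegative to bound the value [0] taken outside the manifold; total mass one
   provides a point of the manifold that witnesses this. *)
have [SE|/set0P[F' /gK SF']] := eqVneq (@stiefel R L M) set0.
  have : P stiefel = 1%E := haarP.1; rewrite SE measure0 => /(congr1 fine) /= /eqP.
  by rewrite eq_sym oner_eq0.
by rewrite normr0 (le_trans _ (ltW Kx)) // (le_trans _ SF').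
Qed.

Definition expect g : R := \int[P]_F cutoff g F.

Lemma expectD g h : sbounded g -> sbounded h ->
  expect (fun F => g F + h F) = expect g + expect h.
Proof.
move=> bg bh; rewrite /expect -RintegralD //; [|exact: sbounded_integrable..].
by apply: eq_Rintegral => F _; rewrite /cutoff; case: ifP; rewrite // addr0.
Qed.

Lemma expectZ a g : sbounded g -> expect (fun F => a * g F) = a * expect g.
Proof.
move=> bg; rewrite /expect -RintegralZl //; last exact: sbounded_integrable.
by apply: eq_Rintegral => F _; rewrite /cutoff; case: ifP; rewrite // mulr0.
Qed.

Lemma expectB g h : sbounded g -> sbounded h ->
  expect (fun F => g F - h F) = expect g - expect h.
Proof.
move=> bg bh; rewrite /expect -RintegralB //; [|exact: sbounded_integrable..].
by apply: eq_Rintegral => F _; rewrite /cutoff; case: ifP; rewrite // subrr.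
Qed.

Lemma expect_le g h : sbounded g -> sbounded h ->
  (forall F, stiefel F -> g F <= h F) -> expect g <= expect h.
Proof.
move=> bg bh gh; apply: le_Rintegral => //; try exact: sbounded_integrable.
by move=> F _; rewrite /cutoff; case: ifPn => // /gh.
Qed.

Lemma expect_cst a : expect (fun=> a) = a.
Proof.
rewrite /expect /Rintegral.
have -> : (\int[P]_F (cutoff (fun=> a) F)%:E = \int[P]_(F in setT) (cst a%:E) F)%E.
  apply: ae_eq_integral => //.
  - by apply/measurable_EFinP; apply: measurable_cutoff; exact: (sbounded_cst a).1.
  - exists (~` stiefel); split.
    + by apply: measurableC; exact: measurable_stiefel.
    + exact: haar_stiefelC.
    + move=> F /= nF SF; apply: nF => _; rewrite /cutoff; move: SF.
      by rewrite /stiefel /= => ->.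
by rewrite integral_cst // [X in (_ * X)%E](@probability_setT _ _ _ P) mule1.
Qed.

Lemma expect_sum I (r : seq I) (G : I -> cmx -> R) :
  (forall i, sbounded (G i)) ->
  expect (fun F => \sum_(i <- r) G i F) = \sum_(i <- r) expect (G i).
Proof.
move=> bG; elim: r => [|i r ih].
  by under eq_fun do rewrite big_nil; rewrite expect_cst big_nil.
under eq_fun do rewrite big_cons; rewrite big_cons expectD ?ih //.
exact: sbounded_sum.
Qed.

Lemma cutoff_mulr (U : 'M[R[i]]_M) g F : U \is unitarymx ->
  cutoff g (F *m U) = cutoff (fun F => g (F *m U)) F.
Proof.
by move=> uU; rewrite /cutoff unitary_mulmxr.
Qed.

Lemma sbounded_mulr (U : 'M[R[i]]_M) g : U \is unitarymx -> sbounded g ->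
  sbounded (fun F => g (F *m U)).
Proof.
move=> uU [mg [K gK]]; split.
  exact: (measurableT_comp mg (measurable_mulmxr U)).
by exists K => F SF; apply: gK; rewrite stiefel_mulmx.
Qed.

Lemma expect_haar (U : 'M[R[i]]_M) g : U \is unitarymx -> sbounded g ->
  expect (fun F => g (F *m U)) = expect g.
Proof.
move=> uU bg; rewrite /expect /Rintegral; congr fine.
rewrite -[RHS](haar_integral haarP uU); last exact: sbounded_integrable.
by apply: eq_integral => F _; rewrite cutoff_mulr.
Qed.

End BoundedExpectation.

Section RealParts.
Variable R : realType.
Implicit Types (x y z : R[i]) (r : R).

Lemma RealB x y : complex.Re (x - y) = complex.Re x - complex.Re y.
Proof. by case: x y => ? ? []. Qed.

Lemma Real_rM r z : complex.Re (r%:C * z) = r * complex.Re z.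
Proof. by case: z => a b /=; rewrite mul0r subr0. Qed.

Lemma le_Real x y : x <= y -> complex.Re x <= complex.Re y.
Proof. by rewrite lecE => /andP[]. Qed.

Lemma norm_Real_le z y : `|z| <= y -> `|complex.Re z| <= complex.Re y.
Proof. by move=> zy; have := le_Real (le_trans (normc_ge_Re z) zy). Qed.

Lemma ge0_RealE z : 0 <= z -> z = (complex.Re z)%:C.
Proof. by move=> /ger0_Im; case: z => a b /= ->. Qed.

End RealParts.

(** * Integration by parts along plane rotations *)

Section IntegrationByParts.
Context {R : realType} {L M : nat}.
Notation cmx := (cmatrix R L M).
Variable P : probability cmx R.
Hypothesis haarP : haar_stiefel P.
Variables (d : 'rV[R[i]]_M) (e : R).
Hypotheses (d0 : forall i, 0 <= d 0 i) (e0 : 0 < e).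

Definition regularized (F : cmx) : 'M[R[i]]_M := cinv (diag_mx (shift d e%:C)) F.
Definition reg_diag k (F : cmx) : R := complex.Re (regularized F k k).
Definition reg_offdiag (w : R[i]) k j (F : cmx) : R :=
  complex.Re (Num.conj w * regularized F k j).

Let eC0 : 0 < e%:C. Proof. by rewrite ltcR. Qed.

Lemma psd_regularized F : psd (regularized F).
Proof. exact/psd_cinv/psd_shift. Qed.

Lemma reg_diagE k F : regularized F k k = (reg_diag k F)%:C.
Proof. exact/ge0_RealE/psd_diag_ge0/psd_regularized. Qed.

Lemma reg_diag_ge0 k F : 0 <= reg_diag k F.
Proof. exact/Real_ge0/psd_diag_ge0/psd_regularized. Qed.

Lemma sbounded_reg_offdiag w k j : `|w| = 1 -> sbounded (reg_offdiag w k j).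
Proof.
move=> w1; split.
  have mX := mxmeasurable_cinv (L := L) (diag_mx (shift d e%:C)).
  exact: (cmeasurableM (cmeasurable_cst _ (Num.conj w)) (mX k j)).1.
exists (complex.Re ((e%:C)^-1)) => F SF; apply: norm_Real_le.
apply: normM1_le; first by rewrite norm_conjC w1.
apply: cinv_entry_le => //; first exact: psd_shift.
by move=> v; apply: qform_diag_ge => i; exact: shift_ge.
Qed.

Lemma sbounded_reg_diag k : sbounded (reg_diag k).
Proof.
have [m [K b]] := sbounded_reg_offdiag k k (normr1 R[i]).
have E : reg_diag k = reg_offdiag 1 k k.
  by apply/funext => F; rewrite /reg_offdiag conjC1 mul1r.
by rewrite E; split=> //; exists K.
Qed.

Variables (j k : 'I_M).
Hypotheses (jk : j != k) (dk : d 0 k = 0).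
Let dj : R := complex.Re (d 0 j).

(** The cosine of the angle whose tangent is [t]. *)
Let rot_scale (t : R) : R[i] := (sqrtC (1 + t%:C ^+ 2))^-1.

Lemma rot_scaleP t : 0 <= t ->
  Num.conj (rot_scale t) = rot_scale t /\
  rot_scale t ^+ 2 * (1 + t%:C ^+ 2) = 1.
Proof.
move=> t0; have p : 0 < 1 + t%:C ^+ 2.
  by rewrite ltr_pwDl // exprn_ge0 // ler0c.
split.
  by apply: CrealP; rewrite realE invr_ge0 sqrtC_ge0 (ltW p).
by rewrite exprVn sqrtCK mulVf // gt_eqF.
Qed.

Definition reg_rotation (t : R) (w : R[i]) := rotation j k (rot_scale t) t%:C w.

Lemma rot_unitary t w : 0 <= t -> `|w| = 1 -> reg_rotation t w \is unitarymx.
Proof.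
move=> t0 w1; have [h1 h2] := rot_scaleP t0.
by apply: rotation_unitary => //; apply: CrealP; rewrite realE ler0c t0.
Qed.

Let err : R := complex.Re (rotation_const (d 0 j) (e%:C)^-1).

(** Real part of [cinv_rotation_expansion], keeping one side of its absolute value bound. The
    bracket on the right is an increment under a unitary change of [F], so its expectation will
    vanish. *)
Lemma reg_offdiag_rot t w F : 0 <= t <= 1 -> `|w| = 1 -> stiefel F ->
  t * (reg_diag k F - reg_diag j F - dj * (reg_diag k F * reg_diag j F
     + complex.Re ((Num.conj w * regularized F k j) ^+ 2)))
  <= (1 + t ^+ 2) * (reg_offdiag w k j (F *m reg_rotation t w) - reg_offdiag w k j F)
     + t ^+ 2 * err.
Proof.
move=> t01 w1 uF; have [cC c2] := rot_scaleP (andP t01).1.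
have tC : 0 <= t%:C <= 1 by move: t01; rewrite -(lecR t 1) ler0c.
have dkj : shift d e%:C 0 k <= shift d e%:C 0 j by rewrite !shiftE lerD2r dk.
have := cinv_rotation_expansion jk cC tC c2 w1 eC0 (shift_ge d0 _) dkj uF.
lazy zeta; rewrite -/(reg_rotation t w) -!/(regularized _) !reg_diagE.
have -> : shift d e%:C 0 j - shift d e%:C 0 k = dj%:C.
  by rewrite !shiftE dk add0r addrK; exact: ge0_RealE.
move=> /norm_Real_le.
set z := (X in `|complex.Re X|).
have -> : z = (1 + t ^+ 2)%:C * (Num.conj w * regularized (F *m reg_rotation t w) k j
       - Num.conj w * regularized F k j)
    - t%:C * ((reg_diag k F)%:C - (reg_diag j F)%:C - dj%:C *
       ((reg_diag k F * reg_diag j F)%:C + (Num.conj w * regularized F k j) ^+ 2)).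
  rewrite /z rmorphD rmorphXn rmorph1 rmorphM /=; ring.
rewrite -rmorphXn Real_rM RealB !Real_rM !RealB Real_rM RealD.
have ReC (r : R) : complex.Re r%:C = r by [].
rewrite (_ : complex.Re (rotation_const dj%:C _) = err); last first.
  by rewrite /err (ge0_RealE (d0 j)).
rewrite -/(reg_offdiag w k j F) -/(reg_offdiag w k j (F *m reg_rotation t w)).
rewrite (ReC (reg_diag k F)) (ReC (reg_diag j F)) (ReC (_ * _)).
move: (reg_diag k F) (reg_diag j F) (complex.Re (_ ^+ 2)) dj err => x y s a b.
move: (reg_offdiag _ _ _ _) (reg_offdiag _ _ _ _) => p q /ler_normlP[h _].
have {}h : t * (x - y - a * (x * y + s)) - (1 + t ^+ 2) * (q - p) <= t ^+ 2 * b.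
  by rewrite -opprB.
by rewrite -lerBlDl.
Qed.

Lemma reg_rot_sum t F : 0 <= t <= 1 -> stiefel F ->
  2 * t * (reg_diag k F - reg_diag j F - dj * (reg_diag k F * reg_diag j F))
  <= (1 + t ^+ 2) *
       ((reg_offdiag 1 k j (F *m reg_rotation t 1) - reg_offdiag 1 k j F)
        + (reg_offdiag 'i%R k j (F *m reg_rotation t 'i%R) - reg_offdiag 'i%R k j F))
     + 2 * t ^+ 2 * err.
Proof.
move=> t01 uF.
have := reg_offdiag_rot t01 (normr1 _) uF.
have := reg_offdiag_rot t01 (normCi _) uF.
set X := regularized F k j.
have -> : (Num.conj 'i%R * X) ^+ 2 = - X ^+ 2.
  by rewrite conjCi mulNr sqrrN exprMn sqrCi mulN1r.
have -> : (Num.conj 1 * X) ^+ 2 = X ^+ 2 by rewrite conjC1 mul1r.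
have -> : complex.Re (- X ^+ 2) = - complex.Re (X ^+ 2) by case: (X ^+ 2).
move: (reg_diag k F) (reg_diag j F) (complex.Re (X ^+ 2)) dj err => x y s a b.
move: (reg_offdiag 'i%R k j (F *m reg_rotation t 'i%R)) (reg_offdiag 'i%R k j F) => p q.
move: (reg_offdiag 1 k j (F *m reg_rotation t 1)) (reg_offdiag 1 k j F) => p' q' h1 h2.
rewrite (_ : 2 * t * _ = t * (x - y - a * (x * y - s)) + t * (x - y - a * (x * y + s))).
  apply: (le_trans (lerD h1 h2)); rewrite le_eqVlt; apply/orP; left; apply/eqP; ring.
ring.
Qed.

(* Adding the expansions for the phases [1] and ['i] cancels the term in
   [X_kj ^+ 2], whose real part has no sign. *)
Lemma expect_by_parts :
  expect P (fun F => reg_diag k F - reg_diag j F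
                     - dj * (reg_diag k F * reg_diag j F)) <= 0.
Proof.
set h := (X in expect P X).
have bk := sbounded_reg_diag k; have bj := sbounded_reg_diag j.
have bh : sbounded h.
  apply: sboundedB; first exact: sboundedB.
  by apply: sboundedM; [exact: sbounded_cst|exact: sboundedM].
have i1 : `|'i%R : R[i]| = 1 by exact: normCi.
have o1 : `|1 : R[i]| = 1 by exact: normr1.
(* The increments have expectation zero by invariance, so integrating [reg_rot_sum] leaves only the
   remainder on the right, and dividing by [2 t] leaves it one factor [t]. *)
have step t : 0 < t <= 1 -> expect P h <= t * err.
  move=> /andP[t0 t1]; have t01 : 0 <= t <= 1 by rewrite ltW.
  pose inc w F := reg_offdiag w k j (F *m reg_rotation t w) - reg_offdiag w k j F.
  have bo w (w1 : `|w| = 1) := sbounded_reg_offdiag k j w1.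
  have ut w (w1 : `|w| = 1) := rot_unitary (ltW t0) w1.
  have bo' w (w1 : `|w| = 1) := sbounded_mulr (ut w w1) (bo w w1).
  have binc w (w1 : `|w| = 1) : sbounded (inc w) := sboundedB (bo' w w1) (bo w w1).
  have Einc w (w1 : `|w| = 1) : expect P (inc w) = 0.
    rewrite /inc (expectB haarP (bo' w w1) (bo w w1)).
    by rewrite (expect_haar haarP (ut w w1) (bo w w1)) subrr.
  have : expect P (fun F => 2 * t * h F) <=
     expect P (fun F => (1 + t ^+ 2) * (inc 1 F + inc 'i%R F) + 2 * t ^+ 2 * err).
    apply: expect_le => //.
    - by apply: sboundedM => //; exact: sbounded_cst.
    - apply: sboundedD; last exact: sbounded_cst.
      apply: sboundedM; first exact: sbounded_cst.
      by apply: sboundedD; exact: binc.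
    by move=> F uF; exact: reg_rot_sum.
  have b2 : sbounded (fun F => inc 1 F + inc 'i%R F) := sboundedD (binc _ o1) (binc _ i1).
  have b3 : sbounded (fun F => (1 + t ^+ 2) * (inc 1 F + inc 'i%R F)).
    by apply: sboundedM => //; exact: sbounded_cst.
  rewrite (expectZ haarP _ bh) (expectD haarP b3 (sbounded_cst _)) (expect_cst haarP).
  rewrite (expectZ haarP _ b2) (expectD haarP (binc _ o1) (binc _ i1)).
  rewrite (Einc _ o1) (Einc _ i1) addr0 mulr0 add0r.
  rewrite (_ : 2 * t ^+ 2 * err = 2 * t * (t * err)); last by ring.
  by rewrite ler_pM2l // mulr_gt0.
rewrite leNgt; apply/negP => Eh.
(* [K] is a positive majorant of [err], and [t] is chosen so that [t * err] is at most half of the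
   supposedly positive expectation. *)
pose K := `|err| + 1; have K0 : 0 < K by rewrite ltr_wpDl.
pose t := Num.min 1 (expect P h / (2 * K)).
have t0 : 0 < t by rewrite lt_min ltr01 divr_gt0 // mulr_gt0.
have t1 : t <= 1 by rewrite ge_min lexx.
have tK : t * K <= expect P h / 2.
  rewrite -ler_pdivlMr //; apply: (@le_trans _ _ (expect P h / (2 * K))).
    by rewrite ge_min lexx orbT.
  by rewrite invfM mulrA.
have := step t; rewrite t0 t1 => /(_ isT).
have : t * err <= t * K by rewrite ler_pM2l // /K ler_wpDr // ler_norm.
by lra.
Qed.

End IntegrationByParts.

(** * Lower limits of sequences of extended reals *)

Section LowerLimit.
Variable R : realType.

Lemma limn_einf_sup_range (u : (\bar R)^nat) :
  limn_einf u = ereal_sup (range (einfs u)).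
Proof.
rewrite limn_einf_lim; apply/cvg_lim => //.
exact/ereal_nondecreasing_cvgn/nondecreasing_einfs.
Qed.

Lemma limn_einf_le (u : (\bar R)^nat) K : (forall n, u n <= K)%E ->
  (limn_einf u <= K)%E.
Proof.
move=> uK; rewrite limn_einf_sup_range; apply: ge_ereal_sup => _ [n _ <-].
by apply: le_trans (uK n); apply: ereal_inf_lbound; exists n => /=.
Qed.

(** From the integer part of [m / e] on, every term is at least [v - e]; so is the infimum of that
    tail, and [e] is arbitrary. *)
Lemma le_limn_einf (u : R^nat) (v m : R) : 0 <= m ->
  (forall n, v <= u n + n.+1%:R^-1 * m) -> (v%:E <= limn_einf (EFin \o u))%E.
Proof.
move=> m0 uv; apply/lee_addgt0Pr => e e0; rewrite limn_einf_sup_range.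
pose n := Num.truncn (m / e).
have nm : m < n.+1%:R * e by rewrite -ltr_pdivrMr // truncnS_gt.
rewrite -leeBlDr //; apply: (@le_trans _ _ (einfs (EFin \o u) n)); last first.
  by apply: ereal_sup_ubound; exists n.
apply: le_ereal_inf_tmp => _ [k /= nk <-]; rewrite -EFinB lee_fin lerBlDr.
apply: (le_trans (uv k)); rewrite lerD2l mulrC ler_pdivrMr // (le_trans (ltW nm)) //.
by rewrite mulrC ler_wpM2l ?(ltW e0) // ler_nat ltnS.
Qed.

Lemma measurable_limn_einf dT (T : measurableType dT) (f : (T -> \bar R)^nat) :
  (forall n, measurable_fun setT (f n)) ->
  measurable_fun setT (fun x => limn_einf (f ^~ x)).
Proof.
move=> mf.
have -> : (fun x => limn_einf (f ^~ x))
    = (fun x => - limn_esup ((fun n x => - f n x) ^~ x))%E.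
  apply/funext => x; rewrite -limn_einfN; congr limn_einf.
  by apply/funext => n /=; rewrite oppeK.
apply: (measurableT_comp (f := fun x : \bar R => (- x)%E)); first exact: oppe_measurable.
by apply: measurable_fun_limn_esup => n; exact: measurableT_comp.
Qed.

End LowerLimit.

(** * Integrability when [L] is below the rank *)

Section Integrability.
Context {R : realType} {L M : nat}.
Notation cmx := (cmatrix R L M).
Variable P : probability cmx R.
Hypothesis haarP : haar_stiefel P.
Variable d : 'rV[R[i]]_M.
Hypothesis d0 : forall i, 0 <= d 0 i.
Hypothesis rank_gt : (L < #|[pred j : 'I_M | d 0%R j != 0%R]|)%N.

Let r := [seq j <- enum 'I_M | d 0 j != 0].
Let dR j : R := complex.Re (d 0 j).
Let B : R := \sum_(j <- r) (dR j)^-1.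

Let mem_r j : (j \in r) = (d 0 j != 0).
Proof. by rewrite mem_filter mem_enum andbT. Qed.

Let size_r : (L < size r)%N.
Proof. by move: rank_gt; rewrite cardE /enum_mem size_filter /r size_filter enumT. Qed.

Lemma Real_sum I (s : seq I) (F : I -> R[i]) :
  complex.Re (\sum_(i <- s) F i) = \sum_(i <- s) complex.Re (F i).
Proof.
by elim: s => [|i s ih]; rewrite ?big_nil // !big_cons RealD ih.
Qed.

(** Sum the integration by parts inequality over the nonzero [d_j] and write [x] for the entry [k].
    There are at least [L + 1] such indices, [sum X_jj <= B] and [sum d_j X_jj <= L], so the summed
    integrand is at least [(L + 1) x - B - L x = x - B]. *)
Lemma expect_reg_diag_le e k : 0 < e -> d 0 k = 0 ->
  expect P (reg_diag d e k) <= B.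
Proof.
move=> e0 dk.
pose h j (F : cmx) := reg_diag d e k F - reg_diag d e j F
   - dR j * (reg_diag d e k F * reg_diag d e j F).
have bd j : sbounded (reg_diag (L := L) d e j) by exact: sbounded_reg_diag.
have bh j : sbounded (h j).
  apply: sboundedB; first exact: sboundedB.
  by apply: sboundedM; [exact: sbounded_cst|exact: sboundedM].
have Eh : expect P (fun F => \sum_(j <- r) h j F) <= 0.
  rewrite (expect_sum haarP) // big_seq sumr_le0 // => j; rewrite mem_r => dj.
  apply: (expect_by_parts haarP d0 e0 _ dk).
  by apply: contra_neq dj => ->.
have : expect P (fun F => reg_diag d e k F - B) <= 0.
  apply: le_trans Eh; apply: (expect_le haarP).
  - by apply: sboundedB => //; exact: sbounded_cst.
  - exact: sbounded_sum.
  move=> F uF; rewrite /h sumrB sumrB big_const_seq count_predT iter_addr_0.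
  rewrite -[X in _ <= X - _ - _]mulr_natl.
  have x0 j : 0 <= reg_diag d e j F by exact: reg_diag_ge0.
  have eC : 0 < e%:C :> R[i] by rewrite ltcR.
  have h1 : \sum_(j <- r) reg_diag d e j F <= B.
    rewrite big_seq [X in _ <= X]big_seq ler_sum // => j; rewrite mem_r => dj.
    have := le_Real (cinv_shift_le d0 uF eC dj); rewrite -/(regularized _ _ _).
    rewrite -/(reg_diag d e j F); congr (_ <= _).
    by rewrite {1}(ge0_RealE (d0 j)) -fmorphV.
  have h2 : \sum_(j <- r) dR j * (reg_diag d e k F * reg_diag d e j F)
      <= L%:R * reg_diag d e k F.
    under eq_bigr do rewrite mulrCA.
    rewrite -mulr_sumr mulrC ler_wpM2r //.
    apply: (@le_trans _ _ (\sum_j dR j * reg_diag d e j F)).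
      rewrite /r big_filter big_enum_cond /= [X in _ <= X](bigID (fun j => d 0 j != 0)) /=.
      rewrite lerDl sumr_ge0 // => j _; rewrite mulr_ge0 //; exact: Real_ge0.
    have := le_Real (sum_cinv_shift_le d0 uF eC); rewrite Real_sum.
    have -> : complex.Re (L%:R : R[i]) = L%:R by rewrite -(rmorph_nat (real_complex R)).
    apply: le_trans; rewrite ler_sum // => j _.
    by rewrite RealM_real.
  have h3 : (L.+1)%:R * reg_diag d e k F <= (size r)%:R * reg_diag d e k F.
    by rewrite ler_wpM2r // ler_nat.
  move: h1 h2 h3; rewrite -[L.+1%:R]natr1.
  move: (\sum_(j <- r) reg_diag _ _ _ _) (\sum_(j <- r) dR j * _) B => a b c.
  move: (reg_diag d e k F) (size r)%:R => x s h1 h2 h3; lra.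
by rewrite (expectB haarP (bd k) (sbounded_cst B)) (expect_cst haarP) subr_le0.
Qed.

Lemma integral_cutoff (g : cmx -> R) : measurable_fun setT g ->
  (\int[P]_F (g F)%:E = \int[P]_F (cutoff g F)%:E)%E.
Proof.
move=> mg; apply: ae_eq_integral => //.
- exact/measurable_EFinP.
- by apply/measurable_EFinP; exact: measurable_cutoff.
exists (~` stiefel); split; [|exact: haar_stiefelC|].
  by apply: measurableC; exact: measurable_stiefel.
move=> F /= nF SF; apply: nF => _; rewrite /cutoff; move: SF.
by rewrite /stiefel /= => ->.
Qed.

Let trD : R := complex.Re (\sum_i d 0 i).

Let trD_ge0 : 0 <= trD.
Proof. by apply: Real_ge0; exact: sumr_ge0. Qed.

Lemma invcov_form_delta_fin k :
  (invcov_form P (diag_mx d) (delta_mx k 0%R) < +oo)%E.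
Proof.
rewrite invcov_formE integral_cutoff; last exact: measurable_form_at.
have myk := measurable_form_at (L := L) (diag_mx d) (delta_mx k 0).
set y := form_at (diag_mx d) (delta_mx k 0) in myk *.
have yE F : y F = complex.Re (cinv (diag_mx d) F k k) by rewrite /y /form_at qform_delta.
have y0 F : 0 <= y F by rewrite /y form_at_ge0 //; exact: psd_diag.
have cy0 F : 0 <= cutoff y F by rewrite /cutoff; case: ifP.
(* An entry with [d_k] nonzero is bounded outright on the manifold; Fatou's lemma treats the kernel
   directions. *)
have [dk|dk] := eqVneq (d 0 k) 0; last first.
  apply: (@le_lt_trans _ _ (complex.Re (\sum_i d 0 i + (d 0 k)^-1))%:E);
    last exact: ltry.
  have by_ : sbounded y.
    split=> //; exists (complex.Re (\sum_i d 0 i + (d 0 k)^-1)) => F uF.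
    by rewrite ger0_norm // yE; apply/le_Real/cinv_le_of_neq0.
  rewrite -(fineK (integrable_fin_num measurableT (sbounded_integrable haarP by_))) lee_fin.
  rewrite -[X in _ <= X](expect_cst haarP); apply: (expect_le haarP) => //.
    exact: sbounded_cst.
  by move=> F uF; rewrite yE; apply/le_Real/cinv_le_of_neq0.
(* The constant [trD] covers the singular compressions, whose default value need not be approached
   by the shifted inverses. *)
pose u n (F : cmx) : R := trD + reg_diag d n.+1%:R^-1 k F.
have e0 n : 0 < n.+1%:R^-1 :> R by rewrite invr_gt0.
have bu n : sbounded (u n).
  by apply: sboundedD; [exact: sbounded_cst|exact: sbounded_reg_diag].
have u0 n F : 0 <= cutoff (u n) F.
  by rewrite /cutoff; case: ifP => // _; rewrite addr_ge0 // reg_diag_ge0.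
apply: (@le_lt_trans _ _ (trD + B)%:E); last exact: ltry.
apply: (@le_trans _ _ (\int[P]_F limn_einf (fun n => (cutoff (u n) F)%:E))%E).
  apply: ge0_le_integral => //.
  - by move=> F _; rewrite lee_fin.
  - by apply/measurable_EFinP; exact: measurable_cutoff.
  - apply: measurable_limn_einf => n.
    by apply/measurable_EFinP; exact: (measurable_cutoff (bu n).1).
  (* Off the manifold every cutoff is zero. On it the constant [m] depends on [F] but not on the
     shift, which suffices for a pointwise lower limit. *)
  move=> F _; rewrite /cutoff; case: ifPn => uF; last first.
    by apply: (@le_limn_einf _ (fun n => 0) 0 0) => // n; rewrite addr_ge0 // mulr_ge0.
  have [m [m0 mP]] := cinv_le_shift d0 k uF.
  apply: (@le_limn_einf _ (fun n => u n F) _ (complex.Re m)); first exact: Real_ge0.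
  move=> n; have eC : 0 < (n.+1%:R^-1)%:C :> R[i] by rewrite ltcR.
  have := le_Real (mP _ eC); rewrite !RealD Real_rM yE.
  exact.
apply: (le_trans (fatou _ _ _ _)) => //.
- by move=> n; apply/measurable_EFinP; exact: (measurable_cutoff (bu n).1).
- by move=> n F _; rewrite lee_fin.
apply: limn_einf_le => n.
have Eu : expect P (u n) = trD + expect P (reg_diag d n.+1%:R^-1 k).
  rewrite -[in RHS](expect_cst haarP trD).
  exact: (expectD haarP (sbounded_cst trD) (sbounded_reg_diag d0 (e0 n) k)).
apply: (@le_trans _ _ (expect P (u n))%:E).
  rewrite /expect /Rintegral fineK //.
  exact: (integrable_fin_num measurableT (sbounded_integrable haarP (bu n))).
by rewrite lee_fin Eu lerD2l expect_reg_diag_le.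
Qed.

(** Each entry is dominated by the sum of two diagonal entries, which are nonnegative with finite
    expectation. *)
Lemma cinv_entry_integrable i j :
  P.-integrable setT (fun F => (complex.Re (cinv (diag_mx d) F i j))%:E) /\
  P.-integrable setT (fun F => (complex.Im (cinv (diag_mx d) F i j))%:E).
Proof.
have pD := psd_diag d0; set D := diag_mx d in pD *.
pose y k : cmx -> R := form_at D (delta_mx k 0).
have iy k : P.-integrable setT (EFin \o y k).
  apply/integrableP; split.
    by apply/measurable_EFinP; exact: measurable_form_at.
  apply: le_lt_trans (invcov_form_delta_fin k); rewrite invcov_formE.
  under eq_integral do rewrite /= ger0_norm ?form_at_ge0 //.
  by [].
have [mRe mIm] := mxmeasurable_cinv (L := L) D i j.
have iyy : P.-integrable setT (EFin \o (fun F => y i F + y j F)).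
  by have := integrableD measurableT (iy i) (iy j).
have bound F : `|cinv D F i j| <= (y i F + y j F)%:C.
  apply: (le_trans (psd_entry_le i j (psd_cinv F pD))).
  have X0 k : 0 <= cinv D F k k by exact/psd_diag_ge0/psd_cinv.
  rewrite ler_pdivrMr // rmorphD /= /y /form_at !qform_delta -!ge0_RealE //.
  by rewrite mulr_natr mulr2n lerDl addr_ge0.
(* Multiplication by the conjugate of ['i] turns the imaginary part into a real part and preserves
   the modulus. *)
have le_norm (z : R[i]) (b : R) : `|z| <= b%:C -> `|complex.Im z| <= b.
  move=> zb; have := @norm_Real_le _ (z * Num.conj 'i%R) b%:C.
  rewrite normrM norm_conjC normCi mulr1 => /(_ zb).
  by case: z {zb} => p q /=; rewrite ?(mulr0, mul0r, mulr1, add0r, mulrN, opprK, mulrN1, sub0r, normrN).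
have y0 F : 0 <= y i F + y j F by rewrite addr_ge0 // form_at_ge0.
split; apply: le_integrable iyy => //; try exact/measurable_EFinP.
  move=> F _; rewrite /= lee_fin [X in _ <= X]ger0_norm //.
  by have := norm_Real_le (bound F).
by move=> F _; rewrite /= lee_fin [X in _ <= X]ger0_norm // le_norm.
Qed.

End Integrability.

(** * Complex and matrix-valued expectations *)

Section ComplexExpectation.
Context {R : realType} {L M : nat}.
Notation cmx := (cmatrix R L M).
Variable P : probability cmx R.
Hypothesis haarP : haar_stiefel P.
Implicit Types f g : cmx -> R[i].

Definition cintegrable f :=
  P.-integrable setT (EFin \o (fun F => complex.Re (f F))) /\
  P.-integrable setT (EFin \o (fun F => complex.Im (f F))).

Definition cexpect f : R[i] :=
  (\int[P]_F complex.Re (f F)) +i* (\int[P]_F complex.Im (f F)).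

Lemma cintegrableD f g : cintegrable f -> cintegrable g ->
  cintegrable (fun F => f F + g F).
Proof.
move=> [f1 f2] [g1 g2]; split.
- apply: eq_integrable (integrableD measurableT f1 g1) => // F _ /=.
  by rewrite RealD.
- apply: eq_integrable (integrableD measurableT f2 g2) => // F _ /=.
  by rewrite ImagD.
Qed.

Lemma cexpectD f g : cintegrable f -> cintegrable g ->
  cexpect (fun F => f F + g F) = cexpect f + cexpect g.
Proof.
move=> [f1 f2] [g1 g2]; rewrite /cexpect.
under [in LHS]eq_Rintegral do rewrite RealD.
under [X in _ +i* X = _]eq_Rintegral do rewrite ImagD.
by rewrite !RintegralD.
Qed.

Lemma cintegrableZ (a : R[i]) f : cintegrable f -> cintegrable (fun F => a * f F).
Proof.
case: a => a b [f1 f2]; split.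
- apply: eq_integrable (integrableB measurableT (integrableZl measurableT a f1)
    (integrableZl measurableT b f2)) => // F _ /=.
  by case: (f F).
- apply: eq_integrable (integrableD measurableT (integrableZl measurableT a f2)
    (integrableZl measurableT b f1)) => // F _ /=.
  by case: (f F).
Qed.

Lemma cexpectZ (a : R[i]) f : cintegrable f ->
  cexpect (fun F => a * f F) = a * cexpect f.
Proof.
case: a => a b [f1 f2].
have i1 (c : R) : P.-integrable setT (EFin \o (fun F => c * complex.Re (f F))).
  by have := integrableZl measurableT c f1.
have i2 (c : R) : P.-integrable setT (EFin \o (fun F => c * complex.Im (f F))).
  by have := integrableZl measurableT c f2.
have mulE (p q u v : R) : (p +i* q) * (u +i* v) = (p * u - q * v) +i* (p * v + q * u) by [].
rewrite /cexpect mulE -!RintegralZl //.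
rewrite -RintegralB // -RintegralD //.
by congr (_ +i* _); apply: eq_Rintegral => F _; case: (f F).
Qed.

Lemma cintegrable0 : cintegrable (fun=> 0).
Proof. by split; exact: integrable0. Qed.

Lemma cexpect0 : cexpect (fun=> 0) = 0.
Proof. by rewrite /cexpect /= /Rintegral integral0. Qed.

Lemma cintegrable_sum I (r : seq I) (G : I -> cmx -> R[i]) :
  (forall i, cintegrable (G i)) -> cintegrable (fun F => \sum_(i <- r) G i F).
Proof.
move=> iG; elim: r => [|i r ih].
  by under eq_fun do rewrite big_nil; exact: cintegrable0.
by under eq_fun do rewrite big_cons; exact: cintegrableD.
Qed.

Lemma cexpect_sum I (r : seq I) (G : I -> cmx -> R[i]) :
  (forall i, cintegrable (G i)) ->
  cexpect (fun F => \sum_(i <- r) G i F) = \sum_(i <- r) cexpect (G i).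
Proof.
move=> iG; elim: r => [|i r ih].
  by under eq_fun do rewrite big_nil; rewrite cexpect0 big_nil.
under eq_fun do rewrite big_cons; rewrite big_cons cexpectD ?ih //.
exact: cintegrable_sum.
Qed.

Definition mxintegrable m n (F : cmx -> 'M[R[i]]_(m, n)) :=
  forall i j, cintegrable (fun x => F x i j).

Definition mxexpect m n (F : cmx -> 'M[R[i]]_(m, n)) : 'M[R[i]]_(m, n) :=
  \matrix_(i, j) cexpect (fun x => F x i j).

Lemma mxintegrable_mull m n p (A : 'M[R[i]]_(m, n)) (F : cmx -> 'M[R[i]]_(n, p)) :
  mxintegrable F ->
  mxintegrable (fun x => A *m F x) /\ mxexpect (fun x => A *m F x) = A *m mxexpect F.
Proof.
move=> iF; split=> [i j|].
  under eq_fun do rewrite mxE.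
  by apply: cintegrable_sum => k; exact: cintegrableZ.
apply/matrixP => i j; rewrite !mxE; under eq_fun do rewrite mxE.
rewrite cexpect_sum; last by move=> k; exact: cintegrableZ.
by apply: eq_bigr => k _; rewrite cexpectZ // mxE.
Qed.

Lemma mxintegrable_mulr m n p (A : 'M[R[i]]_(n, p)) (F : cmx -> 'M[R[i]]_(m, n)) :
  mxintegrable F ->
  mxintegrable (fun x => F x *m A) /\ mxexpect (fun x => F x *m A) = mxexpect F *m A.
Proof.
have comm i j x : (F x *m A) i j = \sum_k A k j * F x i k.
  by rewrite mxE; apply: eq_bigr => k _; rewrite mulrC.
move=> iF; split=> [i j|].
  under eq_fun do rewrite comm.
  by apply: cintegrable_sum => k; exact: cintegrableZ.
apply/matrixP => i j; rewrite !mxE; under eq_fun do rewrite comm.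
rewrite cexpect_sum; last by move=> k; exact: cintegrableZ.
by apply: eq_bigr => k _; rewrite cexpectZ // mxE mulrC.
Qed.

Lemma mxintegrable_haar m n (F : cmx -> 'M[R[i]]_(m, n)) (U : 'M[R[i]]_M) :
  U \is unitarymx -> mxintegrable F ->
  mxintegrable (fun x => F (x *m U)) /\ mxexpect (fun x => F (x *m U)) = mxexpect F.
Proof.
move=> uU iF; split=> [i j|].
  have [i1 i2] := iF i j; split.
  - exact: (haar_integrable haarP uU i1).
  - exact: (haar_integrable haarP uU i2).
apply/matrixP => i j; rewrite !mxE /cexpect /Rintegral; have [i1 i2] := iF i j.
congr (fine _ +i* fine _).
- exact: (haar_integral haarP uU i1).
- exact: (haar_integral haarP uU i2).
Qed.

Lemma invcovE A : invcov P A = mxexpect (fun F => cinv A F).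
Proof. by apply/matrixP => i j; rewrite !mxE unlock. Qed.

(** By [cinv_mulr] the integrand of the conjugate is that of [A] at [F *m U], placed between [U] and
    its adjoint. Linearity takes the constant factors out, and invariance removes [U] from the
    argument. *)
Lemma invcov_conj A (U : 'M[R[i]]_M) : U \is unitarymx ->
  mxintegrable (fun F => cinv A F) ->
  mxintegrable (fun F => cinv (U *m A *m U^t*) F) /\
  invcov P (U *m A *m U^t*) = U *m invcov P A *m U^t*.
Proof.
move=> uU iA; have [iAU eAU] := mxintegrable_haar uU iA.
have [i1 e1] := mxintegrable_mull U iAU.
have [i2 e2] := mxintegrable_mulr (U^t*) i1.
have E : (fun F => cinv (U *m A *m U^t*) F) = (fun F : cmx => U *m cinv A (F *m U) *m U^t*).
  apply/funext => F; rewrite cinv_mulr; move: (cinv _ F) => X.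
  by rewrite !mulmxA (unitarymxP uU) mul1mx -mulmxA (unitarymxP uU) mulmx1.
split; first by rewrite E.
rewrite (invcovE A) -eAU -e1 -e2; transitivity (mxexpect (fun F => cinv (U *m A *m U^t*) F)).
  exact: invcovE.
by rewrite E.
Qed.

End ComplexExpectation.

(** * Equivariance, diagonality and the equal positive tail *)

Theorem mainTheorem4 (R : realType) (L N M : nat)
    (P : probability (cmatrix R L M) R)
    (K U : 'M[R[i]]_M) (d : 'rV[R[i]]_M)
    (L_gt0 : (1 <= L)%N) (leLN : (L <= N)%N) (ltNM : (N < M)%N)
    (haarP : haar_stiefel P)
    (psdK : psdmx K) (rankK : \rank K = N)
    (unitaryU : U \is unitarymx)
    (decK : K = U *m diag_mx d *m U^t*)
    (d_sorted : forall i j : 'I_M, (i <= j)%N -> d 0 j <= d 0 i)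
    (d_tail : forall i : 'I_M, (N <= i)%N -> d 0 i = 0) :
  let D := diag_mx d in
  (* L < N: the expectations exist, as complex matrices *)
  ((L < N)%N ->
     [/\ invcov_exists P K, invcov_exists P D,
         invcov P K = U *m invcov P D *m U^t* &
         [/\ is_diag_mx (invcov P D),
             forall i : 'I_M, invcov P K *m col i U = invcov P D i i *: col i U &
             exists mu : R[i], 0 < mu /\
               forall i : 'I_M, (N <= i)%N -> invcov P D i i = mu]])
  /\
  (* all L <= N, including L = N where the entries of the expectation diverge:
     the same claims for the [0, +oo]-valued quadratic forms *)
  [/\ forall v : 'cV[R[i]]_M, invcov_form P K v = invcov_form P D (U^t* *m v),
      forall v : 'cV[R[i]]_M,
        invcov_form P D v =
          (\sum_(i < M) (complex.Re (`|v i 0%R| ^+ 2)%R)%:E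
                          * invcov_form P D (delta_mx i 0%R))%E &
      exists mu : \bar R, (0 < mu)%E /\
        forall i : 'I_M, (N <= i)%N -> invcov_form P D (delta_mx i 0) = mu].
Proof.
move=> D.
(* [d 0 i] is the form of [K] at the eigenvector [U e_i]. *)
have d0 i : 0 <= d 0 i.
  have [_ /(_ (U *m delta_mx i 0))] := psdK.
  rewrite -/(qform K _) decK qform_congr mulmxA unitary_mulVmx // mul1mx.
  by rewrite qform_delta mxE eqxx.
have pD : psd D by exact: psd_diag.
(* Unitary factors preserve the rank, and the rank of a diagonal matrix counts its nonzero entries;
   this turns [L < N] into the hypothesis of the integrability lemmas. *)
have card_d : #|[pred i : 'I_M | d 0%R i != 0%R]| = N.
  have uUt : U^t* \is unitarymx by rewrite trmxC_unitary.
  rewrite -rank_diag_mx -rankK decK mxrankMfree; last first.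
    by rewrite row_free_unit; exact: unitarymx_unit.
  have fullU : row_full U by rewrite row_full_unit (unitarymx_unit unitaryU).
  by rewrite (eqmxMfull _ fullU).
have [j dj] : exists j, d 0 j != 0.
  have : (0 < #|[pred i : 'I_M | d 0%R i != 0%R]|)%N by rewrite card_d (leq_trans L_gt0).
  by move=> /card_gt0P[j]; exists j.
have LM : (0 < L < M)%N by rewrite L_gt0 (leq_ltn_trans leLN).
(* Indices start at zero, so [N] is the first index of the tail; the later ones are compared with it
   by transpositions. *)
pose i0 := Ordinal ltNM.
have form_tail (i : 'I_M) : (N <= i)%N ->
    invcov_form P D (delta_mx i 0) = invcov_form P D (delta_mx i0 0).
  by move=> Ni; apply: (invcov_form_swap haarP d0); rewrite !d_tail /=.
have form_gt0 : (0 < invcov_form P D (delta_mx i0 0%R))%E.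
  apply: (invcov_form_delta_gt0 haarP LM d0 dj).
  by apply: contra_neq dj => ->; rewrite d_tail /=.
split; last first.
  split.
  - by move=> v; rewrite decK (invcov_form_conj haarP).
  - exact: (invcov_form_diag haarP d0).
  - by exists (invcov_form P D (delta_mx i0 0)).
move=> ltLN; rewrite -card_d in ltLN.
have iD : mxintegrable P (fun F => cinv D F).
  by move=> i k; exact: (cinv_entry_integrable haarP d0 ltLN i k).
have [iK eK] := invcov_conj haarP unitaryU iD.
(* The sign change of coordinate [i] fixes [D] and negates the entry [(i, k)], which therefore
   equals its opposite. *)
have diagD i k : i != k -> invcov P D i k = 0.
  move=> ik; have [_ eS] := invcov_conj haarP (diag_unitary (norm_flip R[i] i)) iD.
  move: eS; rewrite (diag_conj_diag d (norm_flip R[i] i)) => /matrixP/(_ i k).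
  rewrite flip_herm mul_mx_diag mul_diag_mx; move: (invcov P D) => Y.
  rewrite [RHS]mxE [X in X * _]mxE !mxE eqxx [k == i]eq_sym (negPf ik) mulN1r mulr1.
  by move/eqP; rewrite -addr_eq0 -mulr2n mulrn_eq0 => /eqP.
(* The diagonal integrand is real and nonnegative, so equality and positivity proved for the
   extended-valued form transfer to the matrix entries. *)
have diag_real i : invcov P D i i = (fine (invcov_form P D (delta_mx i 0)))%:C.
  rewrite invcovE mxE /cexpect invcov_formE.
  have X0 F : 0 <= cinv D F i i by exact/psd_diag_ge0/psd_cinv.
  congr (_ +i* _).
    rewrite /Rintegral; congr fine; apply: eq_integral => F _.
    by rewrite /form_at qform_delta.
  transitivity (\int[P]_F (cst 0 F : R)).
    by apply: eq_Rintegral => F _ /=; exact: ger0_Im.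
  by rewrite /Rintegral integral0.
split.
- by rewrite decK => i k; exact: iK.
- by move=> i k; exact: iD.
- by rewrite decK.
split.
- by apply/is_diag_mxP => i k; exact: diagD.
- move=> i; rewrite {1}decK eK colE !mulmxA -(mulmxA _ (U^t*)) unitary_mulVmx // mulmx1.
  rewrite -mulmxA scalemxAr; congr (_ *m _); rewrite -colE.
  apply/matrixP => a b; rewrite (ord1 b) [LHS]mxE [RHS]mxE [X in _ * X]mxE eqxx andbT.
  by have [->|ai] := eqVneq a i; rewrite ?mulr1 // mulr0 diagD.
(* [fine] sends [+oo] to [0], so positivity of the witness also uses that the form is finite. *)
- exists (fine (invcov_form P D (delta_mx i0 0)))%:C; split.
    rewrite ltcR fine_gt0 // form_gt0.
    exact: (invcov_form_delta_fin haarP d0 ltLN).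
  by move=> i Ni; rewrite diag_real form_tail.
Qed.
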